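(* Let $L=(L_t:t\ge 0)$ be a L\'evy subordinator. For each $n\ge 1$ consider a mixed coherent system with $n$ components and signature vector $s^{(n)}=(s^{(n)}_1,\dots,s^{(n)}_n)\in\Delta^n$, whose component failure times $(T_1,\dots,T_n)$ are jointly distributed according to the L\'evy-frailty Marshall-Olkin distribution on $\mathbb{R}^n$ with underlying subordinator $L$ (the same for all $n$). Let $T_{\mathrm{sys}}^{(n)}$ be the failure time of the $n$-th system. For each $n$ let $Q_n$ be a random variable with $\mathbb{P}(Q_n=k/(n+1))=s^{(n)}_k$ for $k=1,\dots,n$. Assume: (A) $Q_n$ converges in distribution, as $n\to\infty$, to a random variable $Q$; (B) $\mathbb{E}\left[\dfrac{1}{\sqrt{Q_n(1-Q_n)}}\right]=o(\sqrt n)$ as $n\to+\infty$. Take $Q$ independent of $L$. Then for all $t>0$, $$\limsup_{n\to\infty}\Big|\mathbb{P}\big(T_{\mathrm{sys}}^{(n)}>t\big)-\mathbb{P}\big(\tau_{-\log(1-Q)}>t\big)\Big|\le \mathbb{P}\big(L_t=-\log(1-Q)\big),$$ where $\tau_B:=\inf\{t>0: L_t>B\}$ denotes the first passage time of $L$ across the level $B$. In particular, for every $t>0$ such that $L_t$ or $Q$ has a density (with respect to Lebesgue measure), $\mathbb{P}(T_{\mathrm{sys}}^{(n)}>t)\to\mathbb{P}(\tau_{-\log(1-Q)}>t)$ as $n\to+\infty$, and the reliability function $R^{(n)}(t)=\mathbb{P}(T_{\mathrm{sys}}^{(n)}>t)$ converges to $\mathbb{P}(L_t<-\log(1-Q))$.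 Consequently, if $Q$ has a density, or $L_t$ has a density for every $t>0$, then $T_{\mathrm{sys}}^{(n)}$ converges in distribution to $\tau_{-\log(1-Q)}$.
   Context: Simplex: $\Delta^n=\{p\in\mathbb{R}^n: p\ge 0,\ \sum_i p_i=1\}$. For $x\in\{0,1\}^n$, $|x|=\sum_i x_i$. L\'evy subordinator: a real-valued L\'evy process (c\`adl\`ag, stationary independent increments) with nondecreasing paths and $L_0=0$. Coherent systems. A system with $n$ components has a structure function $\Phi:\{0,1\}^n\to\{0,1\}$; $x_i=1$ means component $i$ works, and $\Phi(x)=1$ means the system works. Component $i$ is irrelevant if $\Phi(x|_{x_i=0})=\Phi(x|_{x_i=1})$ for all $x$, where $x|_{x_i=y}$ is $x$ with its $i$-th entry replaced by $y$. The system is monotone if $\Phi(x|_{x_i=0})\le\Phi(x|_{x_i=1})$ for all $i$ and all $x$. It is coherent if it is monotone and has no irrelevant component. Mixed coherent systems. A mixed coherent system of size $n$ is a random choice among the finitely many coherent systems of size $n$: if $\Phi^1,\dots,\Phi^m$ are all the structure functions of coherent systems of size $n$ and $(p^1,\dots,p^m)$ is a probability vector, its structure function $\Phi$ is random, equal to $\Phi^j$ with probability $p^j$; this random choice is independent of the component failure times. Its signature is $s\in\Delta^n$ with $s_k=\phi_{n-k+1}-\phi_{n-k}$, $k=1,\dots,n$, where $\phi_{n-k}=\binom{n}{n-k}^{-1}\sum_{x\in\{0,1\}^n,\,|x|=n-k}\mathbb{E}\,\Phi(x)$. L\'evy-frailty Marshall-Olkin (LFMO) distribution on $\mathbb{R}^n$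 with underlying subordinator $L$: the law of $(T_1,\dots,T_n)$ with $T_i=\inf\{t\ge 0: L_t>\varepsilon_i\}$, where $\varepsilon_1,\dots,\varepsilon_n$ are i.i.d. standard exponential (rate 1) random variables independent of $L$. System failure time: components are non-repairable, component $i$ works at time $t$ iff $T_i>t$, and $T_{\mathrm{sys}}^{(n)}$ is the first time at which the system stops working, i.e. $T_{\mathrm{sys}}^{(n)}=\inf\{t\ge 0:\Phi(\mathbf 1_{\{T_1>t\}},\dots,\mathbf 1_{\{T_n>t\}})=0\}$. Conventions: $\inf\emptyset=+\infty$ and $-\log 0=+\infty$. *)

(* Defs.v *)
From HB Require Import structures.
From mathcomp Require Import all_boot all_order all_algebra.
From mathcomp Require Import all_classical all_reals all_analysis.
From mathcomp Require Import measurable_realfun.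

Set Implicit Arguments.
Unset Strict Implicit.
Unset Printing Implicit Defensive.

Import Order.TTheory GRing.Theory Num.Theory.
Import numFieldNormedType.Exports.

Local Open Scope classical_set_scope.
Local Open Scope ring_scope.

Section Independence.
Context {d : measure_display} {T : measurableType d} {R : realType}.
Variable P : probability T R.
Local Open Scope ereal_scope.

Definition indep_systems (F G : set (set T)) : Prop :=
  forall A B, F A -> G B -> P (A `&` B) = P A * P B.

(** Subfamilies are covered by taking [B i := setT]. *)
Definition mutually_independent (n : nat) (X : 'I_n -> T -> R) : Prop :=
  forall B : 'I_n -> set R, (forall i, measurable (B i)) ->
    P [set w | forall i, B i (X i w)] =
    \big[*%E/1]_(i < n) P (X i @^-1` B i).

End Independence.

Definition sigma_family {I T : Type} {d' : measure_display}
    {E : measurableType d'} (D : set I) (X : I -> T -> E) : set (set T) :=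
  <<s \bigcup_(i in D) preimage_set_system setT (X i) measurable >>.

Definition has_density {d : measure_display} {T : measurableType d}
    {R : realType} (P : probability T R) (X : T -> R) : Prop :=
  exists f : R -> R,
    [/\ measurable_fun setT f, (forall x, 0 <= f x) &
        forall B, measurable B ->
          P (X @^-1` B) = (\int[lebesgue_measure]_(x in B) (f x)%:E)%E].

(** Convergence of the distribution functions at every real continuity point
    of the limit.  For random variables with values in [[-oo, +oo]], this is
    weak convergence of laws on the compact space [\bar R]; for real ones it is
    the usual notion. *)
Definition cvg_in_distribution {R : realType}
    {dn : nat -> measure_display} {Tn : forall n, measurableType (dn n)}
    (Pn : forall n, probability (Tn n) R) (Xn : forall n, Tn n -> \bar R)
    {d : measure_display} {T : measurableType d}
    (P : probability T R) (X : T -> \bar R) : Prop :=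
  forall t : R,
    {for t, continuous (fun s : R => P [set w | (X w <= s%:E)%E])} ->
    Pn n [set w | (Xn n w <= t%:E)%E] @[n --> \oo] -->
      P [set w | (X w <= t%:E)%E].

Section Levy.
Context {R : realType}.

(** A process is a family [L : R -> T -> R], of which only the times [t >= 0]
    are meaningful. *)
Record levy_process {d : measure_display} {T : measurableType d}
    (P : probability T R) (L : R -> T -> R) : Prop := LevyProcess {
  levy_measurable : forall t, 0 <= t -> measurable_fun setT (L t) ;
  levy_start : forall w, L 0 w = 0 ;
  levy_right_continuous : forall w t, 0 <= t ->
    L s w @[s --> t^'+] --> L t w ;
  levy_left_limits : forall w t, 0 < t -> cvg (L s w @[s --> t^'-]) ;
  levy_stationary : forall s h, 0 <= s -> 0 <= h ->
    forall B : set R, measurable B ->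
      P [set w | B (L (s + h) w - L s w)] = P [set w | B (L h w - L 0 w)] ;
  levy_independent : forall (m : nat) (t : nat -> R), 0 <= t 0%N ->
    (forall i, t i <= t i.+1) ->
    mutually_independent P (fun (i : 'I_m) w => L (t i.+1) w - L (t i) w) }.

Definition levy_subordinator {d : measure_display} {T : measurableType d}
    (P : probability T R) (L : R -> T -> R) : Prop :=
  levy_process P L /\
  forall w s t, 0 <= s -> s <= t -> L s w <= L t w.

Definition same_law {d : measure_display} {T : measurableType d}
    (P : probability T R) (L : R -> T -> R)
    {d' : measure_display} {T' : measurableType d'}
    (P' : probability T' R) (L' : R -> T' -> R) : Prop :=
  forall (m : nat) (t : 'I_m -> R) (B : 'I_m -> set R),
    (forall i, 0 <= t i) -> (forall i, measurable (B i)) ->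
    P [set w | forall i, B i (L (t i) w)] =
    P' [set w | forall i, B i (L' (t i) w)].

(** First passage time across the level [B] of one path [l]. *)
Definition passage_time (l : R -> R) (B : \bar R) : \bar R :=
  ereal_inf [set t%:E | t in [set t | 0 < t /\ (B < (l t)%:E)%E]].

Definition LFMO_time (l : R -> R) (e : R) : \bar R :=
  ereal_inf [set t%:E | t in [set t | 0 <= t /\ e < l t]].

(** [mu] is the Levy-frailty Marshall-Olkin law on [n]-tuples with underlying
    subordinator [L].  The space carrying [L] need not support an independent
    exponential sample, hence the copy [L'] of [L] on another space.  Failure
    times are extended: they may be [+oo] (e.g. when [L = 0]). *)
Definition LFMO_law {d : measure_display} {T : measurableType d}
    (P : probability T R) (L : R -> T -> R)
    (n : nat) (mu : set (n.-tuple (\bar R)) -> \bar R) : Prop :=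
  exists (d' : measure_display) (T' : measurableType d')
         (P' : probability T' R) (L' : R -> T' -> R) (eps : 'I_n -> T' -> R),
  [/\ levy_subordinator P' L' /\ same_law P L P' L',
      (forall i, measurable_fun setT (eps i)) /\
      (forall i B, measurable B ->
         P' (eps i @^-1` B) = exponential_prob 1 B),
      mutually_independent P' eps,
      indep_systems P' (sigma_family [set t : R | 0 <= t] L')
                       (sigma_family [set: 'I_n] eps) &
      forall A : set (n.-tuple (\bar R)), measurable A ->
        mu A = P' [set w | A [tuple LFMO_time (L' ^~ w) (eps i w) | i < n]]].

End Levy.

Section Systems.
Variable n : nat.

Definition state := {ffun 'I_n -> bool}.
Definition structure_function := {ffun state -> bool}.

Definition set_component (x : state) (i : 'I_n) (y : bool) : state :=
  [ffun j => if j == i then y else x j].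

Definition irrelevant (phi : structure_function) (i : 'I_n) : bool :=
  [forall x : state,
     phi (set_component x i false) == phi (set_component x i true)].

Definition monotone_structure (phi : structure_function) : bool :=
  [forall i : 'I_n, forall x : state,
     (phi (set_component x i false) <= phi (set_component x i true))%N].

Definition coherent (phi : structure_function) : bool :=
  monotone_structure phi && [forall i : 'I_n, ~~ irrelevant phi i].

Definition coherent_system := {phi : structure_function | coherent phi}.

Definition system_time {R : realType} (phi : structure_function)
    (T : 'I_n -> \bar R) : \bar R :=
  ereal_inf [set t%:E | t in
    [set t : R | 0 <= t /\ phi [ffun i => (t%:E < T i)%E] = false]].

Context {d : measure_display} {W : measurableType d} {R : realType}.
Variables (P : probability W R) (Phi : W -> coherent_system).

(** [Phi w] is the system drawn at [w]; the mixing probabilities are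
    [P (Phi @^-1` [set phi])]. *)
Definition mixed_coherent_system : Prop :=
  forall phi : coherent_system, measurable (Phi @^-1` [set phi]).

Definition mean_structure (j : nat) : R :=
  ('C(n, j)%:R)^-1 *
  \sum_(x : state | (\sum_(i < n) x i == j)%N)
     fine ('E_P[fun w => (val (Phi w) x)%:R])%E.

(** [signature k] is [s_k], for [1 <= k <= n]. *)
Definition signature (k : nat) : R :=
  mean_structure (n - k + 1) - mean_structure (n - k).

End Systems.

(* Main.v *)
(** Given [L], the components that have failed by time [t] form a Bernoulli
    sample with success probability [q = 1 - exp (- L_t)], so that
    [P (Tsys > t) = E [b_n (q)]] where [b_n (q)] is the mean, for a binomial
    variable [N] of parameters [n] and [q], of the tail [P (Qn > N / (n + 1))];
    this tail is the mean structure function at [n - N].  Since [N / n]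
    concentrates at [q] (Chebyshev), convergence in distribution of [Qn] squeezes
    [b_n (q)] asymptotically between [P (Q > q)] and [P (Q >= q)].  By dominated
    convergence [P (Tsys > t)] is then asymptotically between [P (Q > q)] and
    [P (Q >= q)] for the random [q], i.e. between [P (L_t < - log (1 - Q))] and
    [P (L_t <= - log (1 - Q))]; so is [P (tau > t)]. *)
From HB Require Import structures.
Require Import Defs.
From mathcomp Require Import all_boot all_order all_algebra.
From mathcomp Require Import all_classical all_reals all_analysis.
From mathcomp Require Import measurable_realfun.
From mathcomp Require Import ring lra.
Import Order.TTheory GRing.Theory Num.Theory.
Import numFieldNormedType.Exports.
Local Open Scope classical_set_scope.
Local Open Scope ring_scope.

(** * Binomial means *)

(** Binomial means are finite sums, so concentration becomes one induction and one quadratic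
    majorant, with no binomial variable in sight. The delicate points are boundary events. Survival
    of a component past [t] lies between [L_t < eps_i] and [L_t <= eps_i] but need not equal either
    one, since the path may or may not stay at its level just after [t]; ties cost nothing there
    because the exponential law has no atom. The same gap between [L_t < level] and [L_t <= level]
    reappears for [tau], but now [Q] may have atoms, so a tie can have positive probability and no
    limit need exist. Hence estimates come in pairs, one for [<] and one for [<=], each an eventual
    inequality up to [e]; the width of the pair is the error term of the theorem. Convergence in
    distribution informs only at continuity points, so thresholds are taken at non-atoms of [Q] near
    [q]. Comparisons are made between [q = 1 - exp (- L_t)] and [Q], where no logarithm and no
    infinite level occurs. *)

Definition bmean {R : realType} (n : nat) (q : R) (f : nat -> R) : R :=
  \sum_(i < n.+1) 'C(n, i)%:R * q ^+ i * (1 - q) ^+ (n - i) * f i.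

(** Pascal's rule, that is, conditioning on the first of [n.+1] trials. The closed forms below
    follow from it by induction on [n]. *)
Lemma bmeanS {R : realType} (n : nat) (q : R) (f : nat -> R) :
  bmean n.+1 q f = q * bmean n q (fun i => f i.+1) + (1 - q) * bmean n q f.
Proof.
rewrite /bmean big_ord_recl /= [in X in _ = _ + X]big_ord_recl /=.
rewrite mulrDr addrCA; congr (_ + _).
  by rewrite !bin0 !subn0 exprS; ring.
rewrite !mulr_sumr.
under eq_bigr => i _ do rewrite /bump /= add1n binS natrD !mulrDl subSS.
rewrite big_split /= addrC; congr (_ + _).
  by apply: eq_bigr => i _; rewrite exprS; ring.
rewrite big_ord_recr /= bin_small// !mul0r addr0.
apply: eq_bigr => i _; rewrite /bump /= add1n.
by rewrite -(subnSK (ltn_ord i)) [(1 - q) ^+ _.+1]exprS; ring.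
Qed.

Lemma bmean_eq {R : realType} (n : nat) (q : R) (f g : nat -> R) :
  (forall i, (i <= n)%N -> f i = g i) -> bmean n q f = bmean n q g.
Proof. by move=> fg; apply: eq_bigr => i _; rewrite fg// -ltnS. Qed.

Lemma bmean_le {R : realType} (n : nat) (q : R) (f g : nat -> R) :
  0 <= q <= 1 -> (forall i, (i <= n)%N -> f i <= g i) ->
  bmean n q f <= bmean n q g.
Proof.
move=> /andP[q0 q1] fg; apply: ler_sum => i _.
apply: ler_wpM2l; last by apply: fg; rewrite -ltnS.
by rewrite !mulr_ge0// exprn_ge0// subr_ge0.
Qed.

Lemma bmeanD {R : realType} (n : nat) (q : R) (f g : nat -> R) :
  bmean n q (fun i => f i + g i) = bmean n q f + bmean n q g.
Proof. by rewrite -big_split; apply: eq_bigr => i _; rewrite mulrDr. Qed.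

Lemma bmeanZ {R : realType} (n : nat) (q a : R) (f : nat -> R) :
  bmean n q (fun i => a * f i) = a * bmean n q f.
Proof. by rewrite mulr_sumr; apply: eq_bigr => i _; rewrite mulrCA. Qed.

Lemma bmean_cst {R : realType} (n : nat) (q a : R) : bmean n q (fun=> a) = a.
Proof.
elim: n => [|n IHn]; last by rewrite bmeanS !IHn; ring.
by rewrite /bmean big_ord1 bin0 !expr0; ring.
Qed.

Lemma bmean0 {R : realType} (n : nat) (f : nat -> R) : bmean n 0 f = f 0%N.
Proof.
elim: n f => [|n IHn] f; last by rewrite bmeanS !IHn; ring.
by rewrite /bmean big_ord1 bin0 !expr0; ring.
Qed.

(** The centre [a] is arbitrary because a success in the first trial moves it to [a - 1]: the
    induction hypothesis is used at both centres. *)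
Lemma bmean_variance {R : realType} (n : nat) (q a : R) :
  bmean n q (fun i => (i%:R - a) ^+ 2) = n%:R * q * (1 - q) + (n%:R * q - a) ^+ 2.
Proof.
elim: n a => [|n IHn] a; first by rewrite /bmean big_ord1 /= bin0 !expr0; ring.
rewrite bmeanS IHn.
rewrite (@bmean_eq _ _ _ _ (fun i => (i%:R - (a - 1)) ^+ 2)); last first.
  by move=> i _; rewrite -[i.+1%:R]natr1; congr (_ ^+ 2); ring.
by rewrite IHn -[n.+1%:R]natr1; ring.
Qed.

(** Chebyshev's inequality as a majorant: the penalty [c * (i - n q)^2] costs [c] times the binomial
    variance [n q (1 - q)], which is at most [n]. *)
Lemma bmean_deviation {R : realType} (n : nat) (q a b c : R) : 0 <= q <= 1 -> (0 < n)%N ->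
  0 <= c ->
  bmean n q (fun i => a + c * (i%:R - n%:R * q) ^+ 2) <= a + c * n%:R.
Proof.
move=> /andP[q0 q1] n0 c0; rewrite bmeanD bmean_cst bmeanZ bmean_variance subrr.
rewrite lerD2l ler_wpM2l// expr0n addr0 -mulrA ler_piMr//.
by rewrite mulr_ile1// ?subr_ge0// lerBlDr lerDl.
Qed.

(** * Independence and exponential variables *)

Lemma prob_setU {d : measure_display} {T : measurableType d} {R : realType}
    (P : probability T R) (A B : set T) :
  measurable A -> measurable B -> A `&` B = set0 ->
  P (A `|` B) = (P A + P B)%E.
Proof. by move=> mA mB AB; rewrite measureU. Qed.

(** The law of the pair agrees with the product of the two laws on rectangles, hence everywhere.
    Fubini then freezes [X] at [w] while [Y] is redrawn at an independent [v]. *)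
Lemma prob_indep_pair {d d1 d2 : measure_display} {T : measurableType d}
    {T1 : measurableType d1} {T2 : measurableType d2} {R : realType}
    (P : probability T R) (X : T -> T1) (Y : T -> T2) (C : set (T1 * T2)) :
  measurable_fun setT X -> measurable_fun setT Y ->
  (forall A B, measurable A -> measurable B ->
     P (X @^-1` A `&` Y @^-1` B) = P (X @^-1` A) * P (Y @^-1` B))%E ->
  measurable C ->
  P [set w | C (X w, Y w)] = (\int[P]_w P [set v | C (X w, Y v)])%E.
Proof.
move=> mX mY XY mC.
pose X' : {mfun T >-> T1} := HB.pack X (isMeasurableFun.Build _ _ _ _ X mX).
pose Y' : {mfun T >-> T2} := HB.pack Y (isMeasurableFun.Build _ _ _ _ Y mY).
have mXY : measurable_fun setT (fun w => (X w, Y w)) by exact: measurable_fun_pair.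
pose XY' : {mfun T >-> (T1 * T2)%type} :=
  HB.pack (fun w => (X w, Y w)) (isMeasurableFun.Build _ _ _ _ _ mXY).
transitivity (distribution P XY' C) => //.
rewrite -(@product_measure_unique _ _ _ _ _ (distribution P X') (distribution P Y')
  (distribution P XY') XY _ mC).
rewrite /product_measure1 ge0_integral_distribution//; last first.
  exact: measurable_fun_xsection.
apply: eq_integral => w _ /=; rewrite /distribution /pushforward.
by congr (P _); apply/seteqP; split => v /=; rewrite /xsection/= inE.
Qed.

Lemma measurable_state {d : measure_display} {T : measurableType d} (n : nat)
    (f : 'I_n -> T -> bool) (phi : pred (state n)) :
  (forall i, measurable_fun setT (f i)) ->
  measurable [set w | phi [ffun i => f i w]].
Proof.
move=> mf.
rewrite (_ : [set w | _] = \bigcup_(x in [set x : state n | phi x])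
    \bigcap_(i in [set: 'I_n]) (f i @^-1` [set x i])).
  apply: fin_bigcup_measurable => [|x _]; first exact: finite_finset.
  apply: fin_bigcap_measurable => [|i _]; first exact: finite_finset.
  by rewrite -[X in measurable X]setTI; exact: mf.
apply/seteqP; split => [w /= pw|w [x /= px fx]].
  by exists [ffun i => f i w] => // i _ /=; rewrite ffunE.
by rewrite (_ : [ffun i => _] = x)//; apply/ffunP => i; rewrite ffunE; exact: fx.
Qed.

Section exponential.
Context {d : measure_display} {T : measurableType d} {R : realType}.
Variables (P : probability T R) (e : T -> R).
Hypothesis me : measurable_fun setT e.
Hypothesis e_law : forall B, measurable B -> P (e @^-1` B) = exponential_prob 1 B.

Let me_ (B : set R) : measurable B -> measurable (e @^-1` B).
Proof. by move=> mB; rewrite -[X in measurable X]setTI; exact: me. Qed.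

Let P_neg : P [set w | e w < 0] = 0%E.
Proof.
rewrite (_ : [set w | _] = e @^-1` `]-oo, 0%R[); last first.
  by apply/seteqP; split => w /=; rewrite in_itv.
rewrite e_law// /exponential_prob integral0_eq// => x /=.
by rewrite in_itv/= => /lt0_exponential_pdf ->.
Qed.

Lemma exponential_atomless (u : R) : P [set w | e w = u] = 0%E.
Proof.
rewrite (_ : [set w | _] = e @^-1` [set u])// e_law// /exponential_prob.
apply: null_set_integral => //; last exact: lebesgue_measure_set1.
by apply/measurable_funTS/measurable_EFinP; exact: measurable_exponential_pdf.
Qed.

Lemma exponential_gt (u : R) : 0 <= u -> P [set w | u < e w] = (expR (- u))%:E.
Proof.
move=> u0.
rewrite (_ : [set w | u < e w] = ~` (e @^-1` `]-oo, u])); last first.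
  by apply/seteqP; split => w /=; rewrite in_itv/= ltNge => /negP.
rewrite probability_setC; last exact: me_.
rewrite (_ : _ @^-1` _ = [set w | e w < 0] `|` e @^-1` `[0, u]); last first.
  apply/seteqP; split => w /=; rewrite !in_itv/=.
    by move=> eu; case: (ltP (e w) 0) => e0; [left|right].
  by case=> [/ltW/le_trans|/andP[]//]; exact.
have m0 : measurable [set w | e w < 0].
  rewrite (_ : [set w | _] = e @^-1` `]-oo, 0%R[); first exact: me_.
  by apply/seteqP; split => w /=; rewrite in_itv.
rewrite prob_setU//; [|exact: me_|]; last first.
  rewrite -subset0 => w [/= w0]; rewrite in_itv/= => /andP[+ _].
  by rewrite leNgt w0.
rewrite P_neg add0e e_law//.
(* At [u = 0] the interval degenerates to a point, which has probability zero; the formula for the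
   law of an interval serves for [u > 0]. *)
move: u0; rewrite le_eqVlt => /predU1P[<-|u0].
  by rewrite set_itv1 -e_law// exponential_atomless oppr0 expR0 sube0.
rewrite exponential_prob_itv0c// mulN1r.
by transitivity (1 - (1 - expR (- u)))%:E => //; congr EFin; ring.
Qed.

Lemma exponential_ge (u : R) : 0 <= u -> P [set w | u <= e w] = (expR (- u))%:E.
Proof.
move=> u0.
rewrite (_ : [set w | u <= e w] = [set w | e w = u] `|` [set w | u < e w]); last first.
  apply/seteqP; split => w /=; first by rewrite le_eqVlt => /predU1P[]; [left|right].
  by case=> [->|/ltW].
have m1 : measurable (e @^-1` [set u]) by exact: me_.
have m2 : measurable [set w | u < e w].
  rewrite (_ : [set w | _] = e @^-1` `]u, +oo[); first exact: me_.
  by apply/seteqP; split => w /=; rewrite in_itv/= andbT.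
rewrite prob_setU//; last by rewrite -subset0 => w [/= ->]; rewrite ltxx.
by rewrite exponential_atomless add0e exponential_gt.
Qed.

End exponential.

(** Disjoint splitting along the finitely many values of [X]. It serves both for the state of the
    components and for the random choice of a structure. *)
Lemma prob_partition {d : measure_display} {T : measurableType d} {R : realType}
    (P : probability T R) (I : finType) (X : T -> I) (A : I -> set T) :
  (forall x, measurable (X @^-1` [set x] `&` A x)) ->
  P [set w | A (X w) w] = (\sum_(x : I) P (X @^-1` [set x] `&` A x))%E.
Proof.
move=> mA.
rewrite (_ : [set w | _] = \bigcup_(x in [set` index_enum I]) (X @^-1` [set x] `&` A x)).
  rewrite measure_fin_bigcup//; [by rewrite -fsbig_seq ?index_enum_uniq|].
  apply/trivIsetP => x y _ _ /eqP xy; rewrite -subset0 => w [[Xx _] [Xy _]].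
  by apply: xy; rewrite -Xx.
apply/seteqP; split => [w Aw|w [x _ [<-]]//].
by exists (X w) => //=; rewrite mem_index_enum.
Qed.

(** The bits [a (eps i)] are independent Bernoulli variables of parameter [p], so a state has
    product probability. The test [a] is abstract because strict and weak comparisons with [eps i]
    are both needed. *)
Lemma prob_state {d : measure_display} {T : measurableType d} {R : realType}
    (P : probability T R) (n : nat) (eps : 'I_n -> T -> R) (a : R -> bool) (p : R)
    (phi : pred (state n)) :
  (forall i, measurable_fun setT (eps i)) -> mutually_independent P eps ->
  measurable_fun setT a -> (forall i, P [set w | a (eps i w)] = p%:E) ->
  P [set w | phi [ffun i => a (eps i w)]] =
  (\sum_(x : state n | phi x) \prod_(i < n) (if x i then p else 1 - p))%:E.
Proof.
move=> meps indep ma pE.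
have mae i b : measurable [set w | a (eps i w) = b].
  have mai : measurable_fun setT (fun w => a (eps i w)) by exact: measurableT_comp.
  by have := mai measurableT [set b]; rewrite setTI; apply.
pose X w : state n := [ffun i => a (eps i w)].
have XE x : X @^-1` [set x] = [set w | forall i, (a @^-1` [set x i]) (eps i w)].
  apply/seteqP; split => [w <- i /=|w /= aw]; first by rewrite ffunE.
  by apply/ffunP => i; rewrite ffunE; exact: aw.
have mX x : measurable (X @^-1` [set x]).
  have := @measurable_state _ _ _ (fun i w => a (eps i w)) (pred1 x)
    (fun i => measurableT_comp ma (meps i)).
  by congr (measurable _); apply/seteqP; split => w /= /eqP.
have XphiE x : X @^-1` [set x] `&` (fun=> phi x) = if phi x then X @^-1` [set x] else set0.
  by case: ifP => px; apply/seteqP; split => w //= [].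
rewrite (@prob_partition _ _ _ P _ X (fun x _ => phi x)); last first.
  by move=> x; rewrite XphiE; case: ifP.
rewrite -sumEFin [RHS]big_mkcond/=; apply: eq_bigr => x _.
rewrite XphiE; case: ifPn => [px|_]; last by rewrite measure0.
rewrite XE (indep (fun i => a @^-1` [set x i])); last first.
  by move=> i; have := ma measurableT [set x i]; rewrite setTI; apply.
rewrite -prodEFin; apply: eq_bigr => i _.
rewrite (_ : _ @^-1` _ = [set w | a (eps i w) = x i])//.
case: (x i); first by rewrite -(pE i).
rewrite (_ : [set w | _] = ~` [set w | a (eps i w)]); last first.
  by apply/seteqP; split => w /=; [move=> ->|move/negP/negPf].
by rewrite probability_setC ?pE//; exact: (mae i true).
Qed.

(** * Coherent systems and first passage times *)

(** Monotonicity is given one component at a time; induction on the number of components where [x]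
    and [y] differ switches them on one by one. *)
Lemma monotone_structure_le {n : nat} (phi : structure_function n) (x y : state n) :
  monotone_structure phi -> (forall i, x i -> y i) -> phi x -> phi y.
Proof.
move=> /forallP phi_mono; have [k] := ubnP #|[pred i | x i != y i]|.
elim: k x => // k IHk x xyk xy phix.
have [i xyi|xyE] := pickP [pred i | x i != y i]; last first.
  suff <- : x = y by [].
  by apply/ffunP => i; have := xyE i => /= /negbFE/eqP.
have xi : x i = false by move: xyi (xy i) => /=; case: (x i) => //; case: (y i) => // _ /(_ isT).
have yi : y i by move: xyi => /=; rewrite xi; case: (y i).
apply: (IHk (set_component x i true)).
- apply: leq_trans (_ : #|[pred j | x j != y j]| <= k)%N; last by rewrite -ltnS.
  apply: proper_card; apply/properP; split.
    apply/fintype.subsetP => j; rewrite !inE ffunE; case: (j =P i) => [->|//].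
    by rewrite yi.
  by exists i => //; rewrite inE ffunE eqxx yi.
- by move=> j; rewrite ffunE; case: (j =P i) => [-> _|_ /xy].
- have /forallP/(_ x) := phi_mono i.
  rewrite (_ : set_component x i false = x) ?phix ?lt0b//.
  by apply/ffunP => j; rewrite ffunE; case: (j =P i) => [->|].
Qed.

(** Relevance of [ord0] makes the structure true in some state, and monotonicity carries this to the
    top. A component must exist: for [n = 0] both constant structures are coherent. *)
Lemma coherent_top {n : nat} (phi : coherent_system n) : (0 < n)%N ->
  val phi [ffun=> true] = true.
Proof.
case: n phi => // n [phi /= /andP[phi_mono /forallP/(_ ord0) irr]] _; move: irr.
rewrite negb_forall => /existsP [x phix].
suff [y phiy] : exists y, phi y.
  by apply: (@monotone_structure_le _ phi y) => // i _; rewrite ffunE.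
move: phix; have [? _|_] := boolP (phi (set_component x ord0 true)); first by eexists; eassumption.
by case: (boolP (phi _)) => // ? _; eexists; eassumption.
Qed.

(** A structure true at the bottom would be constantly true by monotonicity, making [ord0]
    irrelevant. *)
Lemma coherent_bottom {n : nat} (phi : coherent_system n) : (0 < n)%N ->
  val phi [ffun=> false] = false.
Proof.
case: n phi => // n [phi /= /andP[phi_mono /forallP/(_ ord0) irr]] _; move: irr.
rewrite negb_forall => /existsP [x].
apply: contra_neqF => phi0.
have phiT y : phi y = true.
  by apply: (@monotone_structure_le _ phi [ffun=> false]) => // i; rewrite ffunE.
by rewrite !phiT.
Qed.

Lemma coherent_monotone {n : nat} (phi : coherent_system n) : monotone_structure (val phi).
Proof. by have /andP[] := valP phi. Qed.

Lemma system_time_gt {R : realType} {n : nat} (phi : structure_function n)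
    (T : 'I_n -> \bar R) (t : R) : 0 <= t -> monotone_structure phi ->
  (t%:E < system_time phi T)%E = phi [ffun i => (t%:E < T i)%E].
Proof.
move=> t0 phi_mono; apply/idP/idP => [|phit].
  apply: contraTT => phit; rewrite -leNgt; apply: ereal_inf_lbound.
  by exists t => //; split => //; apply/negbTE.
(* [m] is the first failure among the components alive at [t], with default [+oo] if there are none.
   Before [m] all of them still work, so by monotonicity the system cannot stop before [m], which is
   beyond [t]. *)
pose m := (\big[mine/+oo]_(i < n | t%:E < T i) T i)%E.
apply: (@lt_le_trans _ _ m).
  by rewrite /m; elim/big_ind: _ => [|a b ta tb|//]; rewrite ?ltry ?lt_min ?ta.
apply: le_ereal_inf_tmp => _ [s [s0 phis] <-]; rewrite leNgt; apply/negP => sm.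
suff : phi [ffun i => (s%:E < T i)%E] by rewrite phis.
apply: (@monotone_structure_le _ phi _ _ phi_mono _ phit) => i; rewrite !ffunE => ti.
by apply: (lt_le_trans sm); rewrite /m (bigD1 i)//= ge_min lexx.
Qed.

(** For an upward closed set, an infimum beyond [t] can be tested along the sequence
    [t + 1 / (k + 1)]. The condition becomes countable, which also yields the measurability of the
    events built on passage times. *)
Lemma inf_upset_gt {R : realType} (D : set R) (t : R) :
  (forall r s, r <= s -> D r -> D s) ->
  (t%:E < ereal_inf [set s%:E | s in D])%E <-> exists k, ~ D (t + k.+1%:R^-1).
Proof.
move=> upD; split => [tD|[k Dk]].
  apply: contrapT => /forallNP Dt.
  have : (ereal_inf [set s%:E | s in D] <= t%:E)%E.
    apply/lee_addgt0Pr => e e0.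
    have [k] := ltr_add_invr e0; rewrite add0r => ke.
    apply: (@le_trans _ _ (t + k.+1%:R^-1)%:E).
      by apply: ereal_inf_lbound; exists (t + k.+1%:R^-1) => //; apply: contrapT; exact: Dt.
    by rewrite -EFinD lee_fin lerD2l ltW.
  by rewrite leNgt tD.
apply: (@lt_le_trans _ _ (t + k.+1%:R^-1)%:E); first by rewrite lte_fin ltrDl.
apply: le_ereal_inf_tmp => _ [s Ds <-]; rewrite lee_fin leNgt; apply/negP => sk.
by apply: Dk; apply: upD Ds; exact: ltW.
Qed.

Section path.
Context {R : realType} (l : R -> R).
Hypothesis l_mono : forall s t, 0 <= s -> s <= t -> l s <= l t.

Lemma LFMO_time_gt (e t : R) : 0 <= t ->
  (t%:E < LFMO_time l e)%E <-> exists k, l (t + k.+1%:R^-1) <= e.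
Proof.
move=> t0; have tk k : 0 <= t + k.+1%:R^-1 by rewrite addr_ge0.
rewrite /LFMO_time inf_upset_gt; last first.
  by move=> r s rs [r0 er]; split; [exact: le_trans rs|apply: (lt_le_trans er); exact: l_mono].
split=> -[k lk]; exists k; first by rewrite leNgt; apply/negP => ?; apply: lk.
by case=> _; rewrite ltNge lk.
Qed.

Lemma passage_time_gt (B : \bar R) (t : R) : 0 <= t ->
  (t%:E < passage_time l B)%E <-> exists k, ((l (t + k.+1%:R^-1))%:E <= B)%E.
Proof.
move=> t0; have tk k : 0 < t + k.+1%:R^-1 by rewrite ltr_wpDl.
rewrite /passage_time inf_upset_gt; last first.
  move=> r s rs [r0 er]; split; first exact: lt_le_trans rs.
  by apply: (lt_le_trans er); rewrite lee_fin l_mono// ltW.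
split=> -[k lk]; exists k; first by rewrite leNgt; apply/negP => ?; apply: lk.
by case=> _; rewrite ltNge lk.
Qed.

Hypothesis l_rc : forall t, 0 <= t -> l s @[s --> t^'+] --> l t.

(** Right continuity keeps a strict inequality alive just after [t]. This gives the half of each
    sandwich of a passage time that monotonicity of the path does not give. *)
Lemma right_continuous_harmonic (e t : R) : 0 <= t -> l t < e ->
  exists k, l (t + k.+1%:R^-1) <= e.
Proof.
move=> t0 lte.
have /cvg_at_rightP/(_ (fun k => t + k.+1%:R^-1)) lk := l_rc _ t0.
have {}lk : l (t + k.+1%:R^-1) @[k --> \oo] --> l t.
  apply: lk; split=> [k|]; first by rewrite ltrDl.
  by rewrite -[X in _ --> X]addr0; apply: cvgD; [exact: cvg_cst|exact: cvg_harmonic].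
by have [N _ /(_ N (leqnn N)) lN] := cvgr_le _ lk _ lte; exists N.
Qed.

End path.

(** * Mixed systems *)

Section mixed_system.
Context {d : measure_display} {W : measurableType d} {R : realType} {n : nat}.
Variables (P : probability W R) (Phi : W -> coherent_system n).
Hypothesis Phi_mixed : mixed_coherent_system Phi.

Lemma expectation_structure (x : state n) :
  ('E_P[fun w => (val (Phi w) x)%:R] =
   \sum_(phi : coherent_system n | val phi x) P (Phi @^-1` [set phi]))%E.
Proof.
have PhiE (phi : coherent_system n) : Phi @^-1` [set phi] `&` (fun=> val phi x) =
    if val phi x then Phi @^-1` [set phi] else set0.
  by case: ifP => px; apply/seteqP; split => w //= [].
have mE (phi : coherent_system n) : measurable (Phi @^-1` [set phi] `&` (fun=> val phi x)).
  by rewrite PhiE; case: ifP.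
have mx : measurable [set w | val (Phi w) x].
  rewrite (_ : [set w | _] = \bigcup_(phi in [set: coherent_system n])
      (Phi @^-1` [set phi] `&` (fun=> val phi x))).
    by apply: fin_bigcup_measurable => [|phi _] //; exact: finite_finset.
  by apply/seteqP; split => [w Pw|w [phi _ [<-]]//]; exists (Phi w).
transitivity (P [set w | val (Phi w) x]).
  rewrite unlock.
  transitivity (\int[P]_w (\1_[set w | val (Phi w) x] w)%:E)%E.
    apply: eq_integral => w _; rewrite indicE.
    have [px|px] := boolP (val (Phi w) x); first by rewrite mem_set.
    by rewrite memNset//; exact/negP.
  by rewrite integral_indic// setIT.
rewrite (@prob_partition _ _ _ P _ Phi (fun phi _ => val phi x))// [RHS]big_mkcond/=.
by apply: eq_bigr => phi _; rewrite PhiE; case: ifP.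
Qed.

Lemma fine_expectation_structure (x : state n) :
  fine ('E_P[fun w => (val (Phi w) x)%:R])%E =
  \sum_(phi : coherent_system n | val phi x) fine (P (Phi @^-1` [set phi])).
Proof.
by rewrite expectation_structure sum_fine// => phi _; rewrite fin_num_measure.
Qed.

Lemma sum_fine_Phi : \sum_(phi : coherent_system n) fine (P (Phi @^-1` [set phi])) = 1.
Proof.
rewrite sum_fine; last by move=> phi _; rewrite fin_num_measure.
have := @prob_partition _ _ _ P _ Phi (fun _ => setT).
rewrite (_ : [set w | _] = setT)// probability_setT => H.
under eq_bigr do rewrite -[X in P X]setIT.
by rewrite -H// => x; rewrite setIT.
Qed.

(** The all-working state is the only one with [n] working components, and every coherent structure
    works there. *)
Lemma mean_structure_top : (0 < n)%N -> mean_structure P Phi n = 1.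
Proof.
move=> n0; rewrite /mean_structure binn invr1 mul1r.
have top (x : state n) : (\sum_(i < n) x i == n)%N -> x = [ffun=> true].
  move=> /eqP sx; apply/ffunP => i; rewrite ffunE; apply/negPn/negP => /negbTE xi.
  have : (\sum_(j < n) x j <= \sum_(j < n | j != i) 1)%N.
    rewrite (bigD1 i)//= xi add0n; apply: leq_sum => j _; exact: leq_b1.
  rewrite sx sum1_card leqNgt => /negP; apply.
  by rewrite (_ : #|_| = #|predC1 i|) ?cardC1 ?card_ord ?prednK//.
rewrite (big_pred1 [ffun=> true]) => [|x /=].
  rewrite fine_expectation_structure -sum_fine_Phi; apply: eq_bigl => phi.
  by rewrite coherent_top.
apply/idP/eqP => [/top//|->].
by rewrite (eq_bigr (fun=> 1%N)) ?sum1_card ?card_ord// => i _; rewrite ffunE.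
Qed.

Lemma mean_structure0 : (0 < n)%N -> mean_structure P Phi 0 = 0.
Proof.
move=> n0; rewrite /mean_structure big1 ?mulr0// => x; rewrite sum_nat_eq0 => /forallP x0.
rewrite fine_expectation_structure big_pred0// => phi.
suff -> : x = [ffun=> false] by rewrite coherent_bottom.
by apply/ffunP => i; rewrite ffunE; have := x0 i; rewrite /= eqb0 => /negbTE.
Qed.

(** The probability of a state depends only on its number of working components, so states may be
    grouped by that number; the factor ['C(n, j)] cancels the normalisation of [mean_structure].
    Here [p] is the probability that a component works, whereas [bmean] counts failures, whence
    [1 - p] and [n - i]. *)
Lemma survival_mix (p : R) :
  \sum_(phi : coherent_system n) fine (P (Phi @^-1` [set phi])) *
    (\sum_(x : state n | val phi x) \prod_(i < n) (if x i then p else 1 - p)) =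
  bmean n (1 - p) (fun i => mean_structure P Phi (n - i)).
Proof.
pose card (x : state n) := (\sum_(i < n) x i)%N.
have card_le x : (card x < n.+1)%N.
  rewrite ltnS -[X in (_ <= X)%N]card_ord -sum1_card.
  by apply: leq_sum => i _; exact: leq_b1.
have prodE (x : state n) : \prod_(i < n) (if x i then p else 1 - p) =
    p ^+ card x * (1 - p) ^+ (n - card x).
  have cardC : (n - card x = \sum_(i < n) ~~ x i)%N.
    apply/eqP; rewrite -(eqn_add2l (card x)) subnKC; last by rewrite -ltnS.
    rewrite -big_split/=; apply/eqP.
    rewrite (eq_bigr (fun=> 1%N)) ?sum1_card ?card_ord// => i _.
    by case: (x i).
  rewrite cardC -!prodrXr -big_split/=; apply: eq_bigr => i _.
  by case: (x i); rewrite /= expr1 expr0 ?mulr1 ?mul1r.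
transitivity (\sum_(x : state n) p ^+ card x * (1 - p) ^+ (n - card x) *
    fine ('E_P[fun w => (val (Phi w) x)%:R])%E).
  under eq_bigr => phi _ do rewrite mulr_sumr big_mkcond/=.
  rewrite exchange_big/=; apply: eq_bigr => x _.
  rewrite fine_expectation_structure mulr_sumr -big_mkcond/=.
  by apply: eq_bigr => phi _; rewrite prodE mulrC.
(* [inord] truncates nothing here, by [card_le]. *)
rewrite (partition_big (fun x => inord (card x) : 'I_n.+1) xpredT)//=.
(* Reversal of the index passes from failed to working components. *)
rewrite /bmean [RHS](reindex_inj rev_ord_inj)/=; apply: eq_bigr => j _.
have jn : (j <= n)%N by rewrite -ltnS.
rewrite ?subSS subKn// bin_sub// /mean_structure.
rewrite (_ : 1 - (1 - p) = p); last by ring.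
rewrite [RHS](_ : _ = ('C(n, j)%:R / 'C(n, j)%:R) * (p ^+ j * (1 - p) ^+ (n - j)) *
  \sum_(x : state n | card x == j) fine ('E_P[fun w => (val (Phi w) x)%:R])%E); last by ring.
rewrite mulfV ?pnatr_eq0 -?lt0n ?bin_gt0// mul1r mulr_sumr.
rewrite (eq_bigl (fun x => card x == j)) => [|x].
  by apply: eq_bigr => x /eqP ->.
by apply/eqP/eqP => [<-|cx]; [rewrite inordK|apply/val_inj; rewrite /= inordK// cx].
Qed.

End mixed_system.

(** * Levy-frailty failure times *)

(** The reliability polynomial of [phi]: the probability that [phi] holds when components work
    independently with probability [p]. *)
Definition survival {R : realType} {n : nat} (phi : pred (state n)) (p : R) : R :=
  \sum_(x : state n | phi x) \prod_(i < n) (if x i then p else 1 - p).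

Lemma survival_ge0 {R : realType} {n : nat} (phi : pred (state n)) (p : R) :
  0 <= p <= 1 -> 0 <= survival phi p.
Proof.
move=> /andP[p0 p1]; apply: sumr_ge0 => x _; apply: prodr_ge0 => i _.
by case: ifP; rewrite ?subr_ge0.
Qed.

Lemma measurable_survival {R : realType} {n : nat} (phi : pred (state n)) :
  measurable_fun setT (@survival R n phi).
Proof.
rewrite /survival; under eq_fun do rewrite big_mkcond/=.
apply: measurable_sum => x; case: (phi x) => //.
apply: measurable_prod => i _; case: (x i) => //.
exact: measurable_funB.
Qed.

Lemma expRN_itv {R : realType} (x : R) : 0 <= x -> 0 <= expR (- x) <= 1.
Proof. by move=> x0; rewrite expR_ge0 -expR0 ler_expR oppr_le0. Qed.

(** Given the frailty [X], the components are independent and each works with probability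
    [exp (- X)]. The levels are gathered into one tuple [Y], so that the pair [(X, Y)] falls under
    [prob_indep_pair]. *)
Lemma prob_frailty_state {d : measure_display} {T : measurableType d} {R : realType}
    (P : probability T R) (n : nat) (X : T -> R) (eps : 'I_n -> T -> R)
    (a : R -> R -> bool) (phi : pred (state n)) :
  measurable_fun setT X -> (forall w, 0 <= X w) ->
  (forall i, measurable_fun setT (eps i)) -> mutually_independent P eps ->
  (forall A B, measurable A -> sigma_family [set: 'I_n] eps B ->
     P (X @^-1` A `&` B) = P (X @^-1` A) * P B)%E ->
  measurable_fun setT (fun z : R * R => a z.1 z.2) ->
  (forall u i, 0 <= u -> P [set w | a u (eps i w)] = (expR (- u))%:E) ->
  P [set w | phi [ffun i => a (X w) (eps i w)]] =
  (\int[P]_w (survival phi (expR (- X w)))%:E)%E.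
Proof.
move=> mX X0 meps ieps iX ma aE.
pose Y w := [tuple eps i w | i < n].
have mY : measurable_fun setT Y.
  apply/measurable_fun_tnthP => i.
  by rewrite (_ : _ \o _ = eps i)//; apply/funext => w /=; rewrite tnth_mktuple.
pose C := [set z : R * n.-tuple R | phi [ffun i => a z.1 (tnth z.2 i)]].
have mC : measurable C.
  apply: (@measurable_state _ _ _ (fun i (z : R * n.-tuple R) => a z.1 (tnth z.2 i))) => i.
  apply: (@measurableT_comp _ _ _ _ _ _ _ _ (fun z : R * n.-tuple R => (z.1, tnth z.2 i)) ma).
  apply: measurable_fun_pair => //=.
  exact: (measurableT_comp (@measurable_tnth _ _ _ i)).
have -> : [set w | phi [ffun i => a (X w) (eps i w)]] = [set w | C (X w, Y w)].
  apply/seteqP; split => w; rewrite /C/=; congr (is_true (phi _)).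
    by apply/ffunP => i; rewrite !ffunE tnth_mktuple.
  by apply/ffunP => i; rewrite !ffunE tnth_mktuple.
rewrite prob_indep_pair//.
  apply: eq_integral => w _; rewrite -(@prob_state _ _ _ P _ eps (a (X w)))//.
  - congr (P _); apply/seteqP; split => v; rewrite /C/=; congr (is_true (phi _)).
      by apply/ffunP => i; rewrite !ffunE tnth_mktuple.
    by apply/ffunP => i; rewrite !ffunE tnth_mktuple.
  - exact: (measurableT_comp ma (measurable_pair1 _)).
  - by move=> i; exact: aE.
move=> A B mA mB; apply: iX => //.
(* Events on the tuple [Y] belong to the sigma-algebra generated by the [eps i], because each
   coordinate of [Y] is measurable for it. *)
pose G := \bigcup_(i in [set: 'I_n]) preimage_set_system setT (eps i) measurable.
have mYG : measurable_fun [set: g_sigma_algebraType G] Y.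
  apply/measurable_fun_tnthP => i.
  rewrite (_ : _ \o _ = eps i); last by apply/funext => w /=; rewrite tnth_mktuple.
  move=> _ D mD; rewrite setTI; apply: sub_gen_smallest.
  by exists i => //; exists D => //; rewrite setTI.
by have := mYG measurableT B mB; rewrite setTI.
Qed.

Section same_law.
Context {d : measure_display} {T : measurableType d} {R : realType}
  {d' : measure_display} {T' : measurableType d'}.
Variables (P : probability T R) (L : R -> T -> R)
  (P' : probability T' R) (L' : R -> T' -> R) (t : R).
Hypotheses (LL' : same_law P L P' L') (t0 : 0 <= t).

Lemma same_law_marginal (B : set R) : measurable B ->
  P (L t @^-1` B) = P' (L' t @^-1` B).
Proof.
move=> mB; have := LL' 1 (fun=> t) (fun=> B) (fun=> t0) (fun=> mB).
rewrite (_ : [set w | _] = L t @^-1` B); last first.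
  by apply/seteqP; split => w /= => [/(_ ord0)|].
rewrite (_ : [set w | forall _, _] = L' t @^-1` B)//.
by apply/seteqP; split => w /= => [/(_ ord0)|].
Qed.

(** Both sides are integrals of [f] against the law at the single time [t], which is how an
    expectation moves between the spaces of [L] and [L']. *)
Lemma same_law_integral (f : R -> \bar R) :
  measurable_fun setT (L t) -> measurable_fun setT (L' t) ->
  measurable_fun setT f -> (forall x, 0 <= f x)%E ->
  (\int[P]_w f (L t w) = \int[P']_w f (L' t w))%E.
Proof.
move=> mL mL' mf f0.
pose X : {mfun T >-> R} := HB.pack (L t) (isMeasurableFun.Build _ _ _ _ _ mL).
pose X' : {mfun T' >-> R} := HB.pack (L' t) (isMeasurableFun.Build _ _ _ _ _ mL').
have := @ge0_integral_distribution _ _ _ _ _ P X f mf f0.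
have := @ge0_integral_distribution _ _ _ _ _ P' X' f mf f0.
move=> /= <- <-; apply: eq_measure_integral => B mB _.
exact: same_law_marginal.
Qed.

End same_law.

Lemma measurable_LFMO_gt {d : measure_display} {T : measurableType d} {R : realType}
    (P : probability T R) (L : R -> T -> R) (e : T -> R) (t : R) :
  levy_subordinator P L -> measurable_fun setT e -> 0 <= t ->
  measurable_fun setT (fun w => (t%:E < LFMO_time (L ^~ w) (e w))%E).
Proof.
move=> [levyL L_mono] me t0; apply: (@measurable_fun_bool _ _ _ _ true).
rewrite setTI (_ : _ @^-1` _ = \bigcup_k [set w | L (t + k.+1%:R^-1) w <= e w]); last first.
  apply/seteqP; split => w /=.
    by move=> /(LFMO_time_gt _ (L_mono w) _ _ t0)[k Lk]; exists k.
  by move=> [k _ Lk]; apply/(LFMO_time_gt _ (L_mono w) _ _ t0); exists k.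
apply: bigcup_measurable => k _.
have mL : measurable_fun setT (L (t + k.+1%:R^-1)).
  by apply: levy_measurable levyL _ _; rewrite addr_ge0.
by have ml := measurable_fun_ler mL me; have := ml measurableT [set true]; rewrite setTI; apply.
Qed.

Lemma subordinator_ge0 {d : measure_display} {T : measurableType d} {R : realType}
    (P : probability T R) (L : R -> T -> R) (t : R) (w : T) :
  levy_subordinator P L -> 0 <= t -> 0 <= L t w.
Proof. by move=> [levyL L_mono] t0; rewrite -(levy_start levyL w) L_mono. Qed.

Lemma measurable_alive {R : realType} (n : nat) (t : R) (phi : pred (state n)) :
  measurable [set T : n.-tuple (\bar R) | phi [ffun i => (t%:E < tnth T i)%E]].
Proof.
apply: (@measurable_state _ _ _ (fun i (T : n.-tuple (\bar R)) => (t%:E < tnth T i)%E)) => i.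
apply: (@measurable_fun_bool _ _ _ _ true); rewrite setTI.
rewrite (_ : _ @^-1` _ =
  (fun T : n.-tuple (\bar R) => tnth T i) @^-1` `]t%:E, +oo%E]%classic); last first.
  by apply/seteqP; split => T /=; rewrite in_itv/= ?leey ?andbT.
rewrite -[X in measurable X]setTI; by apply: measurable_tnth => //; exact: emeasurable_itv.
Qed.

Lemma LFMO_state_prob {d : measure_display} {W : measurableType d} {R : realType}
    (P : probability W R) (L : R -> W -> R) (n : nat)
    (mu : set (n.-tuple (\bar R)) -> \bar R) (t : R) (phi : structure_function n) :
  levy_subordinator P L -> LFMO_law P L mu -> 0 <= t -> monotone_structure phi ->
  mu [set T | phi [ffun i => (t%:E < tnth T i)%E]] =
  (\int[P]_w (survival phi (expR (- L t w)))%:E)%E.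
Proof.
move=> subL [d' [T' [P' [L' [eps [[subL' LL'] [meps eps_law] ieps iLeps muE]]]]]] t0 phi_mono.
have [levyL L_mono] := subL; have [levyL' L'_mono] := subL'.
have mL := levy_measurable levyL t0; have mL' := levy_measurable levyL' t0.
have iX A B : measurable A -> sigma_family [set: 'I_n] eps B ->
    (P' (L' t @^-1` A `&` B) = P' (L' t @^-1` A) * P' B)%E.
  move=> mA sB; apply: iLeps => //; apply: sub_gen_smallest.
  by exists t => //; exists A => //; rewrite setTI.
(* The transfer of integrals wants an integrand nonnegative on the whole line, not only at values of
   [L t]; the absolute value achieves this without changing the integral. *)
have absL w : `|L t w| = L t w by rewrite ger0_norm// (subordinator_ge0 P).
have absL' w : `|L' t w| = L' t w by rewrite ger0_norm// (subordinator_ge0 P').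
have absE : (\int[P]_w (survival phi (expR (- L t w)))%:E =
    \int[P']_w (survival phi (expR (- L' t w)))%:E)%E.
  transitivity (\int[P]_w (survival phi (expR (- `|L t w|)))%:E)%E.
    by apply: eq_integral => w _; rewrite absL.
  rewrite (same_law_integral _ _ _ _ _ LL' t0
      (fun u => (survival phi (expR (- `|u|)))%:E) mL mL').
  - by apply: eq_integral => w _; rewrite absL'.
  - apply/measurable_EFinP; apply: measurableT_comp; first exact: measurable_survival.
    by apply: measurableT_comp => //; apply: measurableT_comp => //; exact: measurableT_comp.
  - by move=> u; rewrite lee_fin survival_ge0// expRN_itv.
have L'0 w : 0 <= L' t w by exact: (subordinator_ge0 P').
have eps_gt u i : 0 <= u -> P' [set w | u < eps i w] = (expR (- u))%:E.
  by move=> u0; exact: (exponential_gt _ _ (meps i) (eps_law i)).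
have eps_ge u i : 0 <= u -> P' [set w | u <= eps i w] = (expR (- u))%:E.
  by move=> u0; exact: (exponential_ge _ _ (meps i) (eps_law i)).
have m_lt : measurable_fun setT (fun z : R * R => z.1 < z.2) by exact: measurable_fun_ltr.
have m_le : measurable_fun setT (fun z : R * R => z.1 <= z.2) by exact: measurable_fun_ler.
have P_lt := prob_frailty_state P' n (L' t) eps
  (fun u e => u < e) phi mL' L'0 meps ieps iX m_lt eps_gt.
have P_le := prob_frailty_state P' n (L' t) eps
  (fun u e => u <= e) phi mL' L'0 meps ieps iX m_le eps_ge.
rewrite muE ?absE; last exact: measurable_alive.
have mlt : measurable [set w | phi [ffun i => L' t w < eps i w]].
  apply: (@measurable_state _ _ _ (fun i w => L' t w < eps i w)) => i.
  exact: measurable_fun_ltr.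
have mle : measurable [set w | phi [ffun i => L' t w <= eps i w]].
  apply: (@measurable_state _ _ _ (fun i w => L' t w <= eps i w)) => i.
  exact: measurable_fun_ler.
pose alive := [set w | phi [ffun i => (t%:E < LFMO_time (L' ^~ w) (eps i w))%E]].
have malive : measurable alive.
  apply: (@measurable_state _ _ _ (fun i w => (t%:E < LFMO_time (L' ^~ w) (eps i w))%E)) => i.
  exact: (measurable_LFMO_gt P').
rewrite (_ : [set w | _] = alive); last first.
  apply/seteqP; split => w; rewrite /alive/=; congr (is_true (phi _)).
    by apply/ffunP => i; rewrite !ffunE tnth_mktuple.
  by apply/ffunP => i; rewrite !ffunE tnth_mktuple.
(* [L' t < eps i] implies survival of [i] at [t], which implies [L' t <= eps i];
   by [prob_frailty_state] both comparisons give [phi] the same probability. *)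
apply/eqP; rewrite eq_le; apply/andP.
split; [rewrite -P_le|rewrite -P_lt]; apply: le_measure; rewrite ?inE// => w /=;
    apply: (monotone_structure_le _ _ _ phi_mono) => i; rewrite !ffunE.
- move=> /(LFMO_time_gt _ (L'_mono w) _ _ t0)[k Lk].
  by apply: le_trans Lk; rewrite L'_mono// lerDl.
- move=> Le; apply/(LFMO_time_gt _ (L'_mono w) _ _ t0).
  exact: (right_continuous_harmonic (L' ^~ w)
    (fun s => @levy_right_continuous _ _ _ _ _ levyL' w s) _ _ t0 Le).
Qed.

(** For a fixed structure, survival of the system past [t] is an event on the failure times alone,
    by [system_time_gt]. Independence of the draw lets the structures be treated one at a time, and
    [survival_mix] sums them back under the integral. *)
Lemma reliability_formula {d : measure_display} {W : measurableType d} {R : realType}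
    (P : probability W R) (L : R -> W -> R) {dE : measure_display}
    {E : measurableType dE} (PS : probability E R) (n : nat)
    (Phi : E -> coherent_system n) (T : {RV PS >-> n.-tuple (\bar R)}) (t : R) :
  levy_subordinator P L -> mixed_coherent_system Phi ->
  LFMO_law P L (distribution PS T) ->
  indep_systems PS (preimage_set_system setT Phi setT)
    (preimage_set_system setT T measurable) -> 0 <= t ->
  PS [set w | (t%:E < system_time (val (Phi w)) (fun i => tnth (T w) i))%E] =
  (\int[P]_w (bmean n (1 - expR (- L t w))
     (fun i => mean_structure PS Phi (n - i)))%:E)%E.
Proof.
move=> subL mPhi LT iPhiT t0.
pose A (phi : coherent_system n) : set (n.-tuple (\bar R)) :=
  [set T | val phi [ffun i => (t%:E < tnth T i)%E]].
have mA phi : measurable (A phi) by exact: measurable_alive.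
have mTA phi : measurable (T @^-1` A phi).
  by rewrite -[X in measurable X]setTI; exact: measurable_funPT.
rewrite (_ : [set w | _] = [set w | (T @^-1` A (Phi w)) w]); last first.
  by apply/seteqP; split => w /=; rewrite system_time_gt//; exact: coherent_monotone.
rewrite (@prob_partition _ _ _ PS _ Phi (fun phi => T @^-1` A phi)); last first.
  by move=> phi; apply: measurableI.
have mL := levy_measurable subL.1 t0.
have msurv (phi : coherent_system n) :
    measurable_fun setT (fun w => (survival (val phi) (expR (- L t w)))%:E).
  apply/measurable_EFinP; apply: measurableT_comp; first exact: measurable_survival.
  by apply: measurableT_comp => //; exact: measurableT_comp.
have surv0 (phi : coherent_system n) w :
    (0 <= (survival (val phi) (expR (- L t w)))%:E)%E.
  by rewrite lee_fin survival_ge0// expRN_itv// (subordinator_ge0 P).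
transitivity (\sum_(phi : coherent_system n) \int[P]_w
    ((fine (PS (Phi @^-1` [set phi])))%:E * (survival (val phi) (expR (- L t w)))%:E))%E.
  apply: eq_bigr => phi _; rewrite iPhiT; last 2 first.
  - by exists [set phi] => //; rewrite setTI.
  - by exists (A phi) => //; rewrite setTI.
  have SP := LFMO_state_prob P L n (distribution PS T) t (val phi) subL LT t0 (coherent_monotone _).
  rewrite (_ : PS (T @^-1` A phi) = distribution PS T (A phi))// SP.
  by rewrite ge0_integralZl// fineK ?fin_num_measure.
rewrite -ge0_integral_sum//.
- apply: eq_integral => w _; rewrite -(survival_mix PS Phi mPhi) -sumEFin.
  by apply: eq_bigr.
- by move=> phi; exact: measurable_funeM.
- by move=> phi w _; rewrite mule_ge0// lee_fin fine_ge0.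
Qed.

(** * Tails and convergence in distribution *)

Section real_probability.
Context {d : measure_display} {T : measurableType d} {R : realType}.
Variables (P : probability T R) (X : T -> R).
Hypothesis mX : measurable_fun setT X.

Lemma measurable_RV_le (y : R) : measurable [set w | X w <= y].
Proof.
have m := measurable_fun_ler mX (measurable_cst y).
by have := m measurableT [set true]; rewrite setTI; apply.
Qed.

Lemma measurable_RV_ge (y : R) : measurable [set w | y <= X w].
Proof.
have m := measurable_fun_ler (measurable_cst y) mX.
by have := m measurableT [set true]; rewrite setTI; apply.
Qed.

Lemma measurable_RV_gt (y : R) : measurable [set w | y < X w].
Proof.
have m := measurable_fun_ltr (measurable_cst y) mX.
by have := m measurableT [set true]; rewrite setTI; apply.
Qed.

Lemma measurable_RV_eq (y : R) : measurable [set w | X w = y].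
Proof. by have := mX measurableT [set y]; rewrite setTI; apply; exact: measurable_set1. Qed.

End real_probability.

Lemma fine_prob_le {d : measure_display} {T : measurableType d} {R : realType}
    (P : probability T R) (A B : set T) : measurable A -> measurable B -> A `<=` B ->
  fine (P A) <= fine (P B).
Proof.
move=> mA mB AB; rewrite fine_le ?fin_num_measure//.
by apply: le_measure; rewrite ?inE.
Qed.

Lemma fine_prob_setC {d : measure_display} {T : measurableType d} {R : realType}
    (P : probability T R) (A : set T) : measurable A ->
  fine (P (~` A)) = 1 - fine (P A).
Proof. by move=> mA; rewrite probability_setC// fineB ?fin_num_measure. Qed.

Lemma fine_prob_setU {d : measure_display} {T : measurableType d} {R : realType}
    (P : probability T R) (A B : set T) : measurable A -> measurable B -> A `&` B = set0 ->
  fine (P (A `|` B)) = fine (P A) + fine (P B).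
Proof. by move=> mA mB AB; rewrite prob_setU// fineD ?fin_num_measure. Qed.

Lemma fine_prob_itv {d : measure_display} {T : measurableType d} {R : realType}
    (P : probability T R) (A : set T) : measurable A -> 0 <= fine (P A) <= 1.
Proof.
move=> mA; rewrite fine_ge0//=.
by rewrite -(@fine1 R) fine_le ?fin_num_measure// probability_le1.
Qed.

(** Continuity from below along the events [x + 1 / (k + 1) < X]. *)
Lemma prob_gt_approx {d : measure_display} {T : measurableType d} {R : realType}
    (P : probability T R) (X : T -> R) (x e : R) : measurable_fun setT X -> 0 < e ->
  exists k, fine (P [set w | x < X w]) - e < fine (P [set w | x + k.+1%:R^-1 < X w]).
Proof.
move=> mX e0; pose F k := [set w | x + k.+1%:R^-1 < X w].
have mF k : measurable (F k) by exact: measurable_RV_gt.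
have FE : \bigcup_k F k = [set w | x < X w].
  apply/seteqP; split => [w [k _]|w /ltr_add_invr [k]].
    by apply: lt_trans; rewrite ltrDl.
  by exists k.
have ndF : nondecreasing_seq F.
  move=> i j ij; apply/subsetPset => w; rewrite /F/=; apply: le_lt_trans.
  by rewrite lerD2l lef_pV2 ?posrE// ler_nat.
have := @nondecreasing_cvg_mu _ _ _ P F mF (bigcupT_measurable F mF) ndF.
rewrite FE -[X in _ --> X -> _]fineK; last by rewrite fin_num_measure//; exact: measurable_RV_gt.
move=> /fine_cvg cF; have Px : fine (P [set w | x < X w]) - e < fine (P [set w | x < X w]).
  by rewrite ltrBlDr ltrDl.
by have [N _ /(_ N (leqnn N)) FN] := cvgr_gt _ cF _ Px; exists N.
Qed.

(** Continuity from above, read off the previous lemma for [- X] through complements. *)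
Lemma prob_ge_approx {d : measure_display} {T : measurableType d} {R : realType}
    (P : probability T R) (X : T -> R) (x e : R) : measurable_fun setT X -> 0 < e ->
  exists k, fine (P [set w | x - k.+1%:R^-1 <= X w]) < fine (P [set w | x <= X w]) + e.
Proof.
move=> mX e0; have mNX : measurable_fun setT (fun w => - X w) by exact: measurableT_comp.
have [k] := prob_gt_approx P _ (- x) _ mNX e0.
have NE y : [set w | - y < - X w] = ~` [set w | y <= X w].
  by apply/seteqP; split => w /=; rewrite ltrN2 ltNge => /negP.
rewrite (_ : - x + _ = - (x - k.+1%:R^-1)); last by ring.
rewrite !NE !fine_prob_setC; try exact: measurable_RV_ge.
by move=> H; exists k; lra.
Qed.

(** Atoms are countably many, whereas an open interval has positive Lebesgue measure. *)
Lemma exists_non_atom {d : measure_display} {T : measurableType d} {R : realType}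
    (P : probability T R) (X : {RV P >-> R}) (a b : R) : a < b ->
  exists2 y, a < y < b & P [set w | X w = y] = 0%E.
Proof.
move=> ab; apply: contrapT => noy.
have sub : `]a, b[ `<=` [set r | 0 < pmf X r].
  move=> y /=; rewrite in_itv/= => aby; rewrite lt_neqAle pmf_ge0 andbT eq_sym.
  apply/eqP => pmf0; apply: noy; exists y => //.
  have mXy : measurable (X @^-1` [set y]) by exact: (measurable_RV_eq X (measurable_funPT X)).
  by rewrite -[LHS]fineK ?fin_num_measure//; congr (_%:E).
have := countable_lebesgue_measure0 (sub_countable (subset_card_le sub) (pmf_gt0_countable X)).
rewrite lebesgue_measure_itv/= lte_fin ab -EFinB => /eqP; rewrite eqe subr_eq0.
by rewrite gt_eqF.
Qed.

(** Without an atom at [y], the tails [P (y < X)] and [P (y <= X)] coincide, so the approximations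
    from the right and from the left meet. *)
Lemma continuous_cdf_non_atom {d : measure_display} {T : measurableType d} {R : realType}
    (P : probability T R) (X : T -> R) (y : R) : measurable_fun setT X ->
  P [set w | X w = y] = 0%E ->
  {for y, continuous (fun s : R => P [set w | ((X w)%:E <= s%:E)%E])}.
Proof.
move=> mX Py.
have setE s : [set w | ((X w)%:E <= s%:E)%E] = ~` [set w | s < X w].
  by apply/seteqP; split => w /=; rewrite lee_fin leNgt => /negP.
have PE s : P [set w | ((X w)%:E <= s%:E)%E] = (1 - fine (P [set w | s < X w]))%:E.
  have mgt := measurable_RV_gt X mX s.
  by rewrite setE -fine_prob_setC// fineK// fin_num_measure//; exact: measurableC.
rewrite /prop_for /continuous_at.
under eq_fun do rewrite PE.
rewrite PE; apply: cvg_EFin; first by apply: nearW.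
apply: cvgB; first exact: cvg_cst.
have PyE : fine (P [set w | y <= X w]) = fine (P [set w | y < X w]).
  rewrite (_ : [set w | y <= X w] = [set w | X w = y] `|` [set w | y < X w]).
    rewrite fine_prob_setU ?Py ?add0r//; [exact: measurable_RV_eq|exact: measurable_RV_gt|].
    by rewrite -subset0 => w [/= ->]; rewrite ltxx.
  apply/seteqP; split => w /=; first by rewrite le_eqVlt => /predU1P[]; [left|right].
  by case=> [->|/ltW].
apply/cvgrPdist_lt => e e0.
have [k1 H1] := prob_gt_approx P X y e mX e0.
have [k2 H2] := prob_ge_approx P X y e mX e0.
have near1 : \forall s \near y, s < y + k1.+1%:R^-1 by apply: lt_nbhsl; rewrite ltrDl.
have near2 : \forall s \near y, y - k2.+1%:R^-1 < s by apply: lt_nbhsr; rewrite ltrBlDr ltrDl.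
near=> s.
have s1 : s < y + k1.+1%:R^-1 by near: s.
have s2 : y - k2.+1%:R^-1 < s by near: s.
have G1 : fine (P [set w | y + k1.+1%:R^-1 < X w]) <= fine (P [set w | s < X w]).
  apply: fine_prob_le; [exact: measurable_RV_gt..|].
  by move=> w /=; apply: lt_trans.
have G2 : fine (P [set w | s < X w]) <= fine (P [set w | y - k2.+1%:R^-1 <= X w]).
  apply: fine_prob_le; [exact: measurable_RV_gt|exact: measurable_RV_ge|].
  by move=> w /= sX; exact: ltW (lt_trans s2 sX).
by rewrite PyE in H2; rewrite ltr_norml; apply/andP; split; lra.
Unshelve. all: by end_near. Qed.

(** The form in which convergence in distribution is used: upper tails, at thresholds that are not
    atoms of the limit. *)
Lemma cvg_tail_non_atom {R : realType} {dQ : nat -> measure_display}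
    {V : forall n, measurableType (dQ n)} (PQ : forall n, probability (V n) R)
    (Qn : forall n, {RV (PQ n) >-> R})
    {d : measure_display} {T : measurableType d} (P : probability T R)
    (Q : {RV P >-> R}) (y : R) :
  cvg_in_distribution PQ (fun n w => (Qn n w)%:E) P (fun w => (Q w)%:E) ->
  P [set w | Q w = y] = 0%E ->
  fine (PQ n [set w | y < Qn n w]) @[n --> \oo] --> fine (P [set w | y < Q w]).
Proof.
move=> hA Py.
have tailE (d' : measure_display) (T' : measurableType d') (P' : probability T' R)
    (X : {RV P' >-> R}) :
    fine (P' [set w | y < X w]) = 1 - fine (P' [set w | ((X w)%:E <= y%:E)%E]).
  rewrite -fine_prob_setC; last exact: (measurable_RV_le X (measurable_funPT X)).
  by congr (fine (P' _)); apply/seteqP; split => w /=; rewrite lee_fin ltNge => /negP.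
under eq_fun do rewrite tailE.
rewrite tailE; apply: cvgB; first exact: cvg_cst.
apply: fine_cvg; rewrite fineK; last first.
  by rewrite fin_num_measure//; exact: (measurable_RV_le Q (measurable_funPT Q)).
by apply: hA; apply: continuous_cdf_non_atom => //; exact: measurable_funPT.
Qed.

(* Summing the atoms on either side of [i / (n + 1)] only gives lower bounds; they
   are attained because they add up to [m n - m 0 = 1]. *)
Lemma signature_tail {d : measure_display} {T : measurableType d} {R : realType}
    (P : probability T R) (X : {RV P >-> R}) (n : nat) (m : nat -> R) :
  m 0%N = 0 -> m n = 1 ->
  (forall k, (1 <= k <= n)%N ->
     P (X @^-1` [set k%:R / n.+1%:R]) = (m (n - k + 1)%N - m (n - k)%N)%:E) ->
  forall i, (i <= n)%N -> fine (P [set w | i%:R / n.+1%:R < X w]) = m (n - i)%N.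
Proof.
move=> m0 mn PX; have mX := measurable_funPT X.
pose x i : R := i%:R / n.+1%:R.
have xlt i : x i < x i.+1 by rewrite /x ltr_pM2r ?invr_gt0 ?ltr0n// ltr_nat.
have mgt := measurable_RV_gt X mX; have mle := measurable_RV_le X mX.
have meq := measurable_RV_eq X mX.
have lower i : (i <= n)%N -> 1 - m (n - i)%N <= fine (P [set w | X w <= x i]).
  elim: i => [_|i IHi lt_in]; first by rewrite subn0 mn subrr fine_ge0.
  apply: (@le_trans _ _ (fine (P ([set w | X w <= x i] `|` [set w | X w = x i.+1])))).
    rewrite fine_prob_setU//; last first.
      by rewrite -subset0 => w [/= Xle Xeq]; move: Xle; rewrite Xeq leNgt xlt.
    have := IHi (ltnW lt_in).
    rewrite (_ : [set w | X w = x i.+1] = X @^-1` [set x i.+1])// PX//=.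
    by rewrite addn1 subnSK//; lra.
  apply: fine_prob_le => //; first exact: measurableU.
  by move=> w [Xx|/= Xx]; [exact: le_trans Xx (ltW (xlt i))|rewrite /mkset Xx].
have upper j : (j <= n)%N -> m j <= fine (P [set w | x (n - j)%N < X w]).
  elim: j => [_|j IHj lt_jn]; first by rewrite m0 fine_ge0.
  have x1 : x (n - j)%N = x (n - j.+1).+1 by rewrite subnSK.
  apply: (@le_trans _ _ (fine (P ([set w | X w = x (n - j)%N] `|` [set w | x (n - j)%N < X w])))).
    rewrite fine_prob_setU//; last by rewrite -subset0 => w [/= ->]; rewrite ltxx.
    have := IHj (ltnW lt_jn).
    rewrite (_ : [set w | X w = _] = X @^-1` [set x (n - j)%N])// PX/=; last first.
      by rewrite subn_gt0 lt_jn leq_subr.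
    by rewrite subKn ?(ltnW lt_jn)// addn1; lra.
  apply: fine_prob_le => //; first exact: measurableU.
  by move=> w [] /= Xx; [rewrite /mkset Xx x1|apply: lt_trans Xx; rewrite x1].
move=> i le_in; apply/eqP; rewrite eq_le; apply/andP; split; last first.
  by have := upper (n - i)%N (leq_subr _ _); rewrite subKn.
have := lower i le_in.
rewrite (_ : [set w | x i < X w] = ~` [set w | X w <= x i]).
  by rewrite fine_prob_setC//; lra.
by apply/seteqP; split => w /=; rewrite ltNge => /negP.
Qed.

(** * Concentration and limits of binomial means of tails *)

(** The constant is the inverse square of half the gap [n delta]: a deviation of that size already
    has weight 1. *)
Lemma chebyshev_weight {R : realType} (n : nat) (delta z : R) : (0 < n)%N -> 0 < delta ->
  n%:R * delta / 2 <= `|z| -> 1 <= 4 / (n%:R * delta) ^+ 2 * z ^+ 2.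
Proof.
move=> n0 d0 nz; have nd0 : 0 < n%:R * delta by rewrite mulr_gt0 ?ltr0n.
rewrite mulrAC ler_pdivlMr ?exprn_gt0// mul1r.
have : (n%:R * delta / 2) ^+ 2 <= `|z| ^+ 2.
  by rewrite ler_pXn2r// nnegrE ?normr_ge0// divr_ge0// ltW.
by rewrite real_normK ?num_real// expr_div_n; lra.
Qed.

(** The second clause pays for the denominator [n + 1] in the values of [Qn], against a count
    centred at [n q]; the third makes the Chebyshev term, equal to [4 / (delta^2 n)], small. *)
Lemma chebyshev_near {R : realType} (delta e : R) : 0 < delta -> 0 < e ->
  \forall n \near \oo, [/\ (0 < n)%N, 2 <= n%:R * delta &
    4 / (n%:R * delta) ^+ 2 * n%:R <= e].
Proof.
move=> d0 e0; near=> n.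
have n0 : (0 < n)%N by near: n; exists 1%N.
have nR : (0 : R) < n%:R by rewrite ltr0n.
split => //.
  by rewrite -ler_pdivrMr//; near: n; exact: nbhs_infty_ger.
rewrite (_ : _ * n%:R = 4 / delta ^+ 2 / n%:R); last first.
  by field; rewrite !gt_eqF.
rewrite ler_pdivrMr// [e * _]mulrC -ler_pdivrMr//.
by near: n; exact: nbhs_infty_ger.
Unshelve. all: by end_near. Qed.

Section binomial_limits.
Context {R : realType} {dQ : nat -> measure_display} {V : forall n, measurableType (dQ n)}
  (PQ : forall n, probability (V n) R) (Qn : forall n, {RV (PQ n) >-> R})
  {d : measure_display} {T : measurableType d} (P : probability T R) (Q : {RV P >-> R})
  (h : nat -> nat -> R).
Hypothesis cvgQ : cvg_in_distribution PQ (fun n w => (Qn n w)%:E) P (fun w => (Q w)%:E).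
Hypothesis h_tail : forall n i, (0 < n)%N -> (i <= n)%N ->
  h n i = fine (PQ n [set w | i%:R / n.+1%:R < Qn n w]).

Let mQ := measurable_funPT Q.

(** Take a non-atom [y] of [Q] just above [q]. If [i / (n + 1) <= y], then [h n i] is at least the
    tail of [Qn] at [y]; otherwise the quadratic penalty is at least 1, which dominates that tail.
    The shares [e / 3] go to the move from [q] to [y], to the convergence of tails at [y], and to
    Chebyshev. *)
Lemma bmean_tail_ge (q e : R) : 0 <= q <= 1 -> 0 < e ->
  \forall n \near \oo, fine (P [set w | q < Q w]) - e <= bmean n q (h n).
Proof.
move=> q01 e0; have /andP[q0 q1] := q01; have e3 : 0 < e / 3 by rewrite divr_gt0.
have [k Hk] := prob_gt_approx P Q q (e / 3) mQ e3.
have qk : q < q + k.+1%:R^-1 by rewrite ltrDl.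
have [y /andP[qy yk] Py] := exists_non_atom P Q _ _ qk.
have Hy : fine (P [set w | q + k.+1%:R^-1 < Q w]) <= fine (P [set w | y < Q w]).
  apply: fine_prob_le; [exact: measurable_RV_gt..|].
  by move=> w /=; apply: lt_trans.
have delta0 : 0 < y - q by rewrite subr_gt0.
near=> n.
have Hn : fine (P [set w | y < Q w]) - e / 3 <= fine (PQ n [set w | y < Qn n w]).
  near: n; apply: (cvgr_ge _ (cvg_tail_non_atom PQ Qn P Q y cvgQ Py)).
  by rewrite ltrBlDr ltrDl.
have [n0 _ nc] : [/\ (0 < n)%N, 2 <= n%:R * (y - q) &
    4 / (n%:R * (y - q)) ^+ 2 * n%:R <= e / 3].
  by near: n; exact: chebyshev_near.
set c := 4 / _ in nc.
have c0 : 0 <= c by rewrite divr_ge0// sqr_ge0.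
pose g := fine (PQ n [set w | y < Qn n w]).
have dev : bmean n q (fun i => - g + c * (i%:R - n%:R * q) ^+ 2) <= - g + c * n%:R.
  exact: bmean_deviation.
(* [bmean_deviation] bounds from above, so it is applied to the opposite of [h]. *)
have : bmean n q (fun i => -1 * h n i) <=
    bmean n q (fun i => - g + c * (i%:R - n%:R * q) ^+ 2).
  apply: bmean_le => // i le_in; rewrite h_tail// mulN1r.
  have [iy|yi] := leP (i%:R / n.+1%:R) y.
    rewrite -[leLHS]addr0; apply: lerD; last by rewrite mulr_ge0 ?sqr_ge0.
    rewrite lerN2.
    apply: fine_prob_le; [exact: measurable_RV_gt..|].
    by move=> w /=; apply: le_lt_trans.
  have /andP[_ g1] : 0 <= g <= 1.
    by apply: fine_prob_itv; exact: measurable_RV_gt.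
  have : 1 <= c * (i%:R - n%:R * q) ^+ 2.
    apply: chebyshev_weight => //.
    apply: le_trans (ler_norm _).
    (* Since [y > q >= 0], replacing [n y] by [(n + 1) y] only widens the gap on this side. *)
    move: yi; rewrite ltr_pdivlMr ?ltr0n// -natr1 mulrDr mulr1 => yi.
    have nd : 0 <= n%:R * (y - q) by rewrite mulr_ge0// ltW.
    by lra.
  have : 0 <= fine (PQ n [set w | i%:R / n.+1%:R < Qn n w]) by rewrite fine_ge0.
  by rewrite /g in g1 *; lra.
by rewrite bmeanZ /g in dev *; lra.
Unshelve. all: by end_near. Qed.

(** Same scheme with the non-atom [y] just below [q]: the penalty now covers the indices with
    [i / (n + 1) < y], where [h n i] is bounded only by 1. *)
Lemma bmean_tail_le (q e : R) : 0 <= q <= 1 -> 0 < e ->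
  \forall n \near \oo, bmean n q (h n) <= fine (P [set w | q <= Q w]) + e.
Proof.
move=> q01 e0; have /andP[q0 q1] := q01; have e3 : 0 < e / 3 by rewrite divr_gt0.
have [k Hk] := prob_ge_approx P Q q (e / 3) mQ e3.
have qk : q - k.+1%:R^-1 < q by rewrite ltrBlDr ltrDl.
have [y /andP[yk qy] Py] := exists_non_atom P Q _ _ qk.
have Hy : fine (P [set w | y < Q w]) <= fine (P [set w | q - k.+1%:R^-1 <= Q w]).
  apply: fine_prob_le; [exact: measurable_RV_gt|exact: measurable_RV_ge|].
  by move=> w /= yQ; exact: ltW (lt_trans yk yQ).
have delta0 : 0 < q - y by rewrite subr_gt0.
near=> n.
have Hn : fine (PQ n [set w | y < Qn n w]) <= fine (P [set w | y < Q w]) + e / 3.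
  near: n; apply: (cvgr_le _ (cvg_tail_non_atom PQ Qn P Q y cvgQ Py)).
  by rewrite ltrDl.
have [n0 n2 nc] : [/\ (0 < n)%N, 2 <= n%:R * (q - y) &
    4 / (n%:R * (q - y)) ^+ 2 * n%:R <= e / 3].
  by near: n; exact: chebyshev_near.
set c := 4 / _ in nc.
have c0 : 0 <= c by rewrite divr_ge0// sqr_ge0.
pose g := fine (PQ n [set w | y < Qn n w]).
have dev : bmean n q (fun i => g + c * (i%:R - n%:R * q) ^+ 2) <= g + c * n%:R.
  exact: bmean_deviation.
have : bmean n q (h n) <= bmean n q (fun i => g + c * (i%:R - n%:R * q) ^+ 2).
  apply: bmean_le => // i le_in; rewrite h_tail//.
  have [yi|iy] := leP y (i%:R / n.+1%:R).
    rewrite -[leLHS]addr0; apply: lerD; last by rewrite mulr_ge0 ?sqr_ge0.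
    apply: fine_prob_le; [exact: measurable_RV_gt..|].
    by move=> w /=; apply: le_lt_trans.
  have : 1 <= c * (i%:R - n%:R * q) ^+ 2.
    apply: chebyshev_weight => //.
    rewrite -normrN; apply: le_trans (ler_norm _).
    (* On this side [(n + 1) y] may exceed [n y], but by less than 1 since [y < q <= 1]. As
       [2 <= n (q - y)], at least half of the gap remains, which is what [chebyshev_weight] asks
       for. *)
    move: iy; rewrite ltr_pdivrMr ?ltr0n// -natr1 mulrDr mulr1 => iy.
    by lra.
  have /andP[_ h1] : 0 <= fine (PQ n [set w | i%:R / n.+1%:R < Qn n w]) <= 1.
    by apply: fine_prob_itv; exact: measurable_RV_gt.
  have : 0 <= g by rewrite fine_ge0.
  by rewrite /g; lra.
by rewrite /g in dev *; lra.
Unshelve. all: by end_near. Qed.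

End binomial_limits.

(** * Passage to the limit *)

(* Also holds for [1 <= x], where [lne] is [-oo] and the level is [+oo]. *)
Lemma level_gt {R : realType} (l x : R) :
  (l%:E < - lne (1 - x)%:E)%E = (1 - expR (- l) < x).
Proof.
rewrite /lne; have [x1|x1] := leP (1 - x) 0.
  have -> : (l%:E < - -oo)%E = true by exact: ltry.
  apply/esym; apply: lt_le_trans (_ : 1 <= x); last by lra.
  by rewrite ltrBlDr ltrDl expR_gt0.
rewrite lte_fin ltrNr -ltr_expR lnK ?posrE//.
by rewrite ltrBlDr -ltrBlDl.
Qed.

Lemma level_ge {R : realType} (l x : R) :
  (l%:E <= - lne (1 - x)%:E)%E = (1 - expR (- l) <= x).
Proof.
rewrite /lne; have [x1|x1] := leP (1 - x) 0.
  have -> : (l%:E <= - -oo)%E = true by exact: leey.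
  apply/esym; apply: le_trans (_ : 1 <= x); last by lra.
  by rewrite lerBlDr lerDl expR_ge0.
rewrite lee_fin lerNr -ler_expR lnK ?posrE//.
by rewrite lerBlDr -lerBlDl.
Qed.

Lemma level_eq {R : realType} (l x : R) :
  l%:E = (- lne (1 - x)%:E)%E <-> 1 - expR (- l) = x.
Proof.
have := level_gt l x; have := level_ge l x.
split=> [/eqP|/eqP]; rewrite eq_le => /andP[].
  rewrite level_ge => le1 ge1; apply/eqP; rewrite eq_le le1 /= leNgt -level_gt.
  by rewrite -leNgt.
move=> le1 ge1; apply/eqP; rewrite eq_le level_ge le1/= leNgt level_gt.
by rewrite -leNgt.
Qed.

Lemma measurable_bmean {R : realType} (n : nat) (f : nat -> R) :
  measurable_fun setT (fun q : R => bmean n q f).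
Proof.
apply: measurable_sum => i; apply: measurable_funM => //.
apply: measurable_funM; last by apply: measurable_funX; exact: measurable_funB.
by apply: measurable_funM => //; exact: measurable_funX.
Qed.

Lemma bmean_itv {R : realType} (n : nat) (q : R) (f : nat -> R) : 0 <= q <= 1 ->
  (forall i, 0 <= f i <= 1) -> 0 <= bmean n q f <= 1.
Proof.
move=> q01 f01; rewrite -{1}(bmean_cst n q 0) -(bmean_cst n q 1).
by rewrite !bmean_le// => i _; have /andP[] := f01 i.
Qed.

Section integral_liminf.
Context {d : measure_display} {T : measurableType d} {R : realType}.
Variable P : probability T R.

Lemma itv_integrable (f : T -> R) : measurable_fun setT f ->
  (forall w, 0 <= f w <= 1) -> P.-integrable setT (EFin \o f).
Proof.
move=> mf f01; apply: (@le_integrable _ _ _ P setT _ _ (EFin \o cst 1)) => //.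
- exact/measurable_EFinP.
- move=> w _ /=; have /andP[f0 f1] := f01 w.
  by rewrite lee_fin !ger0_norm.
- exact: finite_measure_integrable_cst.
Qed.

(** The bound on [f n] is one-sided, so [f n] itself need not converge; its truncation [min (f n) g]
    converges pointwise to [g] and is dominated by 1. *)
Lemma integral_liminf (f : nat -> T -> R) (g : T -> R) :
  (forall n, measurable_fun setT (f n)) -> measurable_fun setT g ->
  (forall n w, 0 <= f n w <= 1) -> (forall w, 0 <= g w <= 1) ->
  (forall w e, 0 < e -> \forall n \near \oo, g w - e <= f n w) ->
  forall e, 0 < e -> \forall n \near \oo,
    fine (\int[P]_w (g w)%:E)%E - e <= fine (\int[P]_w (f n w)%:E)%E.
Proof.
move=> mf mg f01 g01 fg e e0.
pose u n w := Num.min (f n w) (g w).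
have mu n : measurable_fun setT (u n) by exact: measurable_minr.
have u01 n w : 0 <= u n w <= 1.
  have /andP[f0 f1] := f01 n w; have /andP[g0 g1] := g01 w.
  by rewrite /u le_min f0 g0 ge_min f1.
have ucvg w : (u n w)%:E @[n --> \oo] --> (g w)%:E.
  apply: cvg_EFin; first exact: nearW.
  apply/cvgrPdist_le => r r0; near=> n.
  have fgn : g w - r <= f n w by near: n; exact: fg.
  have ug : u n w <= g w by rewrite /u ge_min lexx orbT.
  rewrite ger0_norm ?subr_ge0// lerBlDr -lerBlDl /u le_min fgn.
  by rewrite lerBlDr lerDl ltW.
have iu n := itv_integrable _ (mu n) (u01 n).
have [_ _ ucvgI] : [/\ P.-integrable setT (fun w => (g w)%:E),
    (\int[P]_w `|(u n w)%:E - (g w)%:E|)%E @[n --> \oo] --> 0%E &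
    (\int[P]_w (u n w)%:E)%E @[n --> \oo] --> (\int[P]_w (g w)%:E)%E].
  apply: (@dominated_convergence _ _ _ P setT measurableT (fun n w => (u n w)%:E)
    (fun w => (g w)%:E) (EFin \o cst 1)).
  - by move=> n; exact/measurable_EFinP.
  - exact/measurable_EFinP.
  - by apply: aeW => w _; exact: ucvg.
  - exact: finite_measure_integrable_cst.
  - apply: aeW => w n _; have /andP[u0 u1] := u01 n w.
    by rewrite /= lee_fin ger0_norm.
have ig := itv_integrable _ mg g01.
have fing : (\int[P]_w (g w)%:E)%E \is a fin_num by exact: integrable_fin_num ig.
move: ucvgI; rewrite -[X in _ --> X -> _]fineK// => /fine_cvg ucvgI.
near=> n; apply: (@le_trans _ _ (fine (\int[P]_w (u n w)%:E)%E)).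
  by near: n; apply: (cvgr_ge _ ucvgI); rewrite ltrBlDr ltrDl.
apply: fine_le.
- exact: integrable_fin_num (iu n).
- exact: integrable_fin_num (itv_integrable _ (mf n) (f01 n)).
apply: ge0_le_integral => //.
- by move=> w _; have /andP[] := u01 n w.
- exact/measurable_EFinP.
- exact/measurable_EFinP.
- by move=> w _; rewrite lee_fin /u ge_min lexx.
Unshelve. all: by end_near. Qed.

(** The previous lemma applied to [1 - f n] and [1 - g]. *)
Lemma integral_limsup (f : nat -> T -> R) (g : T -> R) :
  (forall n, measurable_fun setT (f n)) -> measurable_fun setT g ->
  (forall n w, 0 <= f n w <= 1) -> (forall w, 0 <= g w <= 1) ->
  (forall w e, 0 < e -> \forall n \near \oo, f n w <= g w + e) ->
  forall e, 0 < e -> \forall n \near \oo,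
    fine (\int[P]_w (f n w)%:E)%E <= fine (\int[P]_w (g w)%:E)%E + e.
Proof.
move=> mf mg f01 g01 fg e e0.
have compl (k : T -> R) : measurable_fun setT k -> (forall w, 0 <= k w <= 1) ->
    fine (\int[P]_w (1 - k w)%:E)%E = 1 - fine (\int[P]_w (k w)%:E)%E.
  move=> mk k01; have ik := itv_integrable _ mk k01.
  have i1 : P.-integrable setT (EFin \o cst (1 : R)) by exact: finite_measure_integrable_cst.
  have -> : (\int[P]_w (1 - k w)%:E = \int[P]_w (cst 1 w)%:E - \int[P]_w (k w)%:E)%E.
    exact: (integralB_EFin measurableT i1 ik).
  have -> : (\int[P]_w (cst (1 : R) w)%:E)%E = 1%E.
    transitivity (\int[P]_w (cst 1%E w))%E => //.
    by rewrite integral_cst// mul1e; exact: probability_setT.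
  rewrite fineB//.
  exact: integrable_fin_num ik.
have flip (x : R) : 0 <= x <= 1 -> 0 <= 1 - x <= 1.
  by move=> /andP[x0 x1]; apply/andP; split; lra.
have := @integral_liminf (fun n w => 1 - f n w) (fun w => 1 - g w).
move=> /(_ (fun n => measurable_funB (measurable_cst _) (mf n))
  (measurable_funB (measurable_cst _) mg) (fun n w => flip _ (f01 n w))
  (fun w => flip _ (g01 w))) H.
have {}H : \forall n \near \oo,
    fine (\int[P]_w (1 - g w)%:E)%E - e <= fine (\int[P]_w (1 - f n w)%:E)%E.
  apply: H => // w r r0; near=> n.
  by have : f n w <= g w + r; [near: n; exact: fg|lra].
near=> n; have : fine (\int[P]_w (1 - g w)%:E)%E - e <= fine (\int[P]_w (1 - f n w)%:E)%E.
  by near: n; exact: H.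
by rewrite !compl//; lra.
Unshelve. all: by end_near. Qed.

End integral_liminf.

Lemma measurable_system_gt {R : realType} {dE : measure_display}
    {E : measurableType dE} (n : nat) (Phi : E -> coherent_system n)
    (T : {mfun E >-> n.-tuple (\bar R)}) (t : R) : mixed_coherent_system Phi -> 0 <= t ->
  measurable [set w | (t%:E < system_time (val (Phi w)) (fun i => tnth (T w) i))%E].
Proof.
move=> mPhi t0.
pose A (phi : coherent_system n) : set (n.-tuple (\bar R)) :=
  [set x | val phi [ffun i => (t%:E < tnth x i)%E]].
rewrite (_ : [set w | _] = \bigcup_(phi in [set: coherent_system n])
    (Phi @^-1` [set phi] `&` T @^-1` A phi)).
  apply: fin_bigcup_measurable => [|phi _]; first exact: finite_finset.
  apply: measurableI => //; rewrite -[X in measurable X]setTI.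
  by apply: measurable_funPT => //; exact: measurable_alive.
have gtE w := system_time_gt (val (Phi w)) (fun i => tnth (T w) i) t t0 (coherent_monotone _).
apply/seteqP; split => [w /=|w [phi _ [<-]]] /=; rewrite gtE//.
by exists (Phi w).
Qed.

Lemma measurable_prob_section {d d1 d2 : measure_display} {T : measurableType d}
    {T1 : measurableType d1} {T2 : measurableType d2} {R : realType}
    (P : probability T R) (Y : T -> T2) (C : set (T1 * T2)) :
  measurable_fun setT Y -> measurable C ->
  measurable_fun setT (fun x => P [set v | C (x, Y v)]).
Proof.
move=> mY mC.
pose Y' : {mfun T >-> T2} := HB.pack Y (isMeasurableFun.Build _ _ _ _ Y mY).
apply: eq_measurable_fun (measurable_fun_xsection (distribution P Y') mC) => x _ /=.
by rewrite /distribution /pushforward; congr (P _);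
  apply/seteqP; split => v /=; rewrite /xsection/= inE.
Qed.

(** The upper limit is an infimum, over eventual sets, of suprema; the set where the bound holds is
    one of them. *)
Lemma limn_esup_le_near {R : realType} (u : nat -> \bar R) (l : \bar R) :
  (forall e : R, 0 < e -> \forall n \near \oo, (u n <= l + e%:E)%E) ->
  (limn_esup u <= l)%E.
Proof.
move=> ul; apply/lee_addgt0Pr => e e0.
rewrite /limn_esup limf_esupE; apply: (@le_trans _ _
  (ereal_sup [set u n | n in [set n | (u n <= l + e%:E)%E]])).
  by apply: ereal_inf_lbound; exists [set n | (u n <= l + e%:E)%E] => //; exact: ul.
by apply: ge_ereal_sup => _ [n /= un <-].
Qed.

Lemma density_atomless {d : measure_display} {T : measurableType d} {R : realType}
    (P : probability T R) (X : T -> R) (x : R) :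
  has_density P X -> P [set w | X w = x] = 0%E.
Proof.
move=> [f [mf _ fE]]; rewrite (_ : [set w | _] = X @^-1` [set x])// fE//.
apply: null_set_integral => //; last exact: lebesgue_measure_set1.
by apply/measurable_funTS/measurable_EFinP.
Qed.

(** * The limit theorem: reliability against first passage *)

Section limit_theorem.
Context {R : realType} {d : measure_display} {W : measurableType d}
  (P : probability W R) (L : R -> W -> R) (Q : {RV P >-> R})
  {dE : nat -> measure_display} {E : forall n : nat, measurableType (dE n)}
  (PS : forall n : nat, probability (E n) R)
  (Phi : forall n : nat, E n -> coherent_system n)
  (T : forall n : nat, {RV (PS n) >-> n.-tuple (\bar R)})
  {dQ : nat -> measure_display} {V : forall n : nat, measurableType (dQ n)}
  (PQ : forall n : nat, probability (V n) R)
  (Qn : forall n : nat, {RV (PQ n) >-> R}).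
Hypotheses (L_subordinator : levy_subordinator P L)
  (Phi_mixed : forall n : nat, (0 < n)%N -> mixed_coherent_system (Phi n))
  (T_LFMO : forall n : nat, (0 < n)%N ->
     LFMO_law P L (distribution (PS n) (T n)))
  (Phi_T_indep : forall n : nat, (0 < n)%N ->
     indep_systems (PS n)
       (preimage_set_system setT (Phi n) setT)
       (preimage_set_system setT (T n) measurable))
  (Qn_signature : forall n k : nat, (0 < n)%N -> (1 <= k <= n)%N ->
     PQ n (Qn n @^-1` [set k%:R / n.+1%:R]) = (signature (PS n) (Phi n) k)%:E)
  (cvgQ : cvg_in_distribution PQ (fun n w => (Qn n w)%:E) P (fun w => (Q w)%:E))
  (Q_L_indep : indep_systems P
     (preimage_set_system setT Q measurable)
     (sigma_family [set t : R | 0 <= t] L)).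

Let Tsys (n : nat) (w : E n) : \bar R :=
  system_time (val (Phi n w)) (fun i => tnth (T n w) i).
Let reliability (n : nat) (t : R) : \bar R := PS n [set w | (t%:E < Tsys n w)%E].
Let q t w := 1 - expR (- L t w).
Let tail n i := fine (PQ n [set w | i%:R / n.+1%:R < Qn n w]).
Let mQ := measurable_funPT Q.
Let mL t (t0 : 0 <= t) := levy_measurable L_subordinator.1 t0.

Let mq t : 0 <= t -> measurable_fun setT (q t).
Proof.
move=> t0; apply: measurable_funB => //; apply: measurableT_comp => //.
by apply: measurableT_comp => //; exact: mL.
Qed.

Let q_itv t w : 0 <= t -> 0 <= q t w <= 1.
Proof.
move=> t0; have := expRN_itv _ (subordinator_ge0 P L t w L_subordinator t0).
by rewrite /q => /andP[p0 p1]; apply/andP; split; lra.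
Qed.

Lemma reliabilityE n t : (0 < n)%N -> 0 <= t ->
  reliability n t = (\int[P]_w (bmean n (q t w) (tail n))%:E)%E.
Proof.
move=> n0 t0.
rewrite /reliability /Tsys (reliability_formula P L (PS n) n (Phi n) (T n) t L_subordinator
  (Phi_mixed n n0) (T_LFMO n n0) (Phi_T_indep n n0) t0).
apply: eq_integral => w _; congr (_%:E); apply: bmean_eq => i le_in.
apply/esym; apply: (signature_tail (PQ n) (Qn n) n (mean_structure (PS n) (Phi n))) => //.
- exact: (mean_structure0 (PS n) (Phi n) (Phi_mixed n n0)).
- exact: (mean_structure_top (PS n) (Phi n) (Phi_mixed n n0)).
- by move=> k kn; rewrite Qn_signature.
Qed.

(** At time 0 the frailty gives [q = 0], no component has failed, and [Qn] is almost surely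
    positive. This handles time 0 in the convergence in distribution. *)
Lemma reliability0 n : (0 < n)%N -> reliability n 0 = 1%E.
Proof.
move=> n0; rewrite reliabilityE//.
transitivity (\int[P]_w (cst 1%E w))%E; last first.
  by rewrite integral_cst// mul1e; exact: probability_setT.
apply: eq_integral => w _ /=; congr (_%:E).
rewrite /q (levy_start L_subordinator.1) oppr0 expR0 subrr bmean0 /tail.
transitivity (mean_structure (PS n) (Phi n) (n - 0)%N); last first.
  by rewrite subn0; exact: (mean_structure_top (PS n) (Phi n) (Phi_mixed n n0)).
apply: (signature_tail (PQ n) (Qn n) n (mean_structure (PS n) (Phi n))) => //.
- exact: (mean_structure0 (PS n) (Phi n) (Phi_mixed n n0)).
- exact: (mean_structure_top (PS n) (Phi n) (Phi_mixed n n0)).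
- by move=> k kn; rewrite Qn_signature.
Qed.

Let L_Q_indep t : 0 <= t -> forall A B, measurable A -> measurable B ->
  (P (L t @^-1` A `&` Q @^-1` B) = P (L t @^-1` A) * P (Q @^-1` B))%E.
Proof.
move=> t0 A B mA mB; rewrite setIC muleC; apply: Q_L_indep.
  by exists B => //; rewrite setTI.
by apply: sub_gen_smallest; exists t => //; exists A => //; rewrite setTI.
Qed.

Let mq1 : measurable_fun setT (fun z : R * R => 1 - expR (- z.1)).
Proof.
apply: measurable_funB => //; apply: measurableT_comp => //.
exact: measurableT_comp.
Qed.

Let tail_itv n i : 0 <= tail n i <= 1.
Proof. by apply: fine_prob_itv; apply: measurable_RV_gt; exact: measurable_funPT. Qed.

(** [L_t] is frozen and [Q] redrawn. The third clause undoes this by independence, turning an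
    integral of pointwise limits into the probability of a comparison; [r] stands for [<] or
    [<=]. *)
Let prob_section (r : R -> R -> bool) t : 0 <= t ->
  measurable_fun setT (fun z : R * R => r (1 - expR (- z.1)) z.2) ->
  [/\ measurable_fun setT (fun w => fine (P [set v | r (q t w) (Q v)])),
      forall w, 0 <= fine (P [set v | r (q t w) (Q v)]) <= 1 &
      fine (\int[P]_w (fine (P [set v | r (q t w) (Q v)]))%:E)%E =
      fine (P [set w | r (q t w) (Q w)])].
Proof.
move=> t0 mr.
pose C := [set z : R * R | r (1 - expR (- z.1)) z.2].
have mC : measurable C by have := mr measurableT [set true]; rewrite setTI; apply.
have mCx u : measurable [set v | C (u, Q v)].
  rewrite (_ : [set v | _] = Q @^-1` xsection C u).
    by rewrite -[X in measurable X]setTI; apply: mQ => //; exact: measurable_xsection.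
  by apply/seteqP; split => v /=; rewrite /xsection/= inE.
split.
- have m1 : measurable_fun setT (fun u => fine (P [set v | C (u, Q v)])).
    by apply: measurableT_comp => //; exact: measurable_prob_section.
  exact: (measurableT_comp m1 (mL _ t0)).
- by move=> w; apply: fine_prob_itv; exact: (mCx (L t w)).
rewrite [in RHS](_ : [set w | _] = [set w | C (L t w, Q w)])//.
rewrite (prob_indep_pair P (L t) Q C (mL _ t0) mQ (L_Q_indep _ t0) mC).
congr (fine _); apply: eq_integral => w _.
by rewrite fineK// fin_num_measure//; exact: (mCx (L t w)).
Qed.

(** For each [w], [bmean_tail_ge] applies at [q t w], but the rank from which it holds depends on
    [w]; the integration therefore goes through [integral_liminf]. *)
Lemma reliability_ge_near t e : 0 <= t -> 0 < e -> \forall n \near \oo,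
  fine (P [set w | q t w < Q w]) - e <= fine (reliability n t).
Proof.
move=> t0 e0.
have [|mg g01 <-] := prob_section (fun a b => a < b) t t0; first exact: measurable_fun_ltr.
near=> n; rewrite reliabilityE//; last by near: n; exists 1%N.
near: n; apply: integral_liminf => //.
- by move=> n; exact: (measurableT_comp (measurable_bmean n (tail n)) (mq _ t0)).
- by move=> n w; apply: bmean_itv => //; exact: q_itv.
- by move=> w r r0; apply: (bmean_tail_ge PQ Qn P Q tail) => //; exact: q_itv.
Unshelve. all: by end_near. Qed.

Lemma reliability_le_near t e : 0 <= t -> 0 < e -> \forall n \near \oo,
  fine (reliability n t) <= fine (P [set w | q t w <= Q w]) + e.
Proof.
move=> t0 e0.
have [|mg g01 <-] := prob_section (fun a b => a <= b) t t0; first exact: measurable_fun_ler.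
near=> n; rewrite reliabilityE//; last by near: n; exists 1%N.
near: n; apply: integral_limsup => //.
- by move=> n; exact: (measurableT_comp (measurable_bmean n (tail n)) (mq _ t0)).
- by move=> n w; apply: bmean_itv => //; exact: q_itv.
- by move=> w r r0; apply: (bmean_tail_le PQ Qn P Q tail) => //; exact: q_itv.
Unshelve. all: by end_near. Qed.

Let level (w : W) : \bar R := (- lne (1 - Q w)%:E)%E.
Let tau (w : W) : \bar R := passage_time (L ^~ w) (level w).

Let m_lt t : 0 <= t -> measurable [set w | q t w < Q w].
Proof.
move=> t0; have m := measurable_fun_ltr (mq t t0) mQ.
by have := m measurableT [set true]; rewrite setTI; apply.
Qed.

Let m_le t : 0 <= t -> measurable [set w | q t w <= Q w].
Proof.
move=> t0; have m := measurable_fun_ler (mq t t0) mQ.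
by have := m measurableT [set true]; rewrite setTI; apply.
Qed.

Let m_eq t : 0 <= t -> measurable [set w | q t w = Q w].
Proof.
move=> t0; rewrite (_ : [set w | _] = [set w | q t w <= Q w] `\` [set w | q t w < Q w]).
  by apply: measurableD; [exact: m_le|exact: m_lt].
apply/seteqP; split => w /=; first by move=> ->; rewrite lexx ltxx; split.
by case=> qQ /negP; rewrite -leNgt => Qq; apply/eqP; rewrite eq_le qQ.
Qed.

Lemma tau_gt t w : 0 <= t ->
  (t%:E < tau w)%E <-> exists k, q (t + k.+1%:R^-1) w <= Q w.
Proof.
move=> t0; rewrite /tau passage_time_gt//; last exact: L_subordinator.2.
by split=> -[k qk]; exists k; move: qk; rewrite /level level_ge.
Qed.

Let m_tau t : 0 <= t -> measurable [set w | (t%:E < tau w)%E].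
Proof.
move=> t0; rewrite (_ : [set w | _] = \bigcup_k [set w | q (t + k.+1%:R^-1) w <= Q w]).
  by apply: bigcup_measurable => k _; apply: m_le; rewrite addr_ge0.
by apply/seteqP; split => w /=; rewrite tau_gt// => -[k]; exists k.
Qed.

(** The lower bound is right continuity of the path in the scale of [q], the upper bound its
    monotonicity. *)
Lemma tau_sandwich t : 0 <= t ->
  fine (P [set w | q t w < Q w]) <= fine (P [set w | (t%:E < tau w)%E]) <=
  fine (P [set w | q t w <= Q w]).
Proof.
move=> t0; apply/andP; split.
- apply: fine_prob_le; [exact: m_lt|exact: m_tau|move=> w /= qQ].
  apply/tau_gt => //.
  apply: (right_continuous_harmonic (q ^~ w)) => // s s0.
  apply: cvgB; first exact: cvg_cst.
  apply: continuous_cvg; first exact: continuous_expR.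
  by apply: cvgN; exact: levy_right_continuous L_subordinator.1 _ _ s0.
- apply: fine_prob_le; [exact: m_tau|exact: m_le|move=> w /= /(tau_gt _ _ t0)[k]].
   apply: le_trans.
  by rewrite lerD2l lerN2 ler_expR lerN2 L_subordinator.2// lerDl.
Qed.

(** By the third clause, the width of the sandwich is exactly the probability of a tie. *)
Lemma prob_level t : 0 <= t ->
  [/\ P [set w | ((L t w)%:E < level w)%E] = P [set w | q t w < Q w],
      P [set w | (L t w)%:E = level w] = P [set w | q t w = Q w] &
      fine (P [set w | q t w <= Q w]) =
        fine (P [set w | q t w < Q w]) + fine (P [set w | q t w = Q w])].
Proof.
move=> t0; split.
- by congr (P _); apply/seteqP; split => w /=; rewrite /level level_gt.
- by congr (P _); apply/seteqP; split => w /= /level_eq.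
rewrite -fine_prob_setU; [|exact: m_lt|exact: m_eq|]; last first.
  by rewrite -subset0 => w [/= + qQ]; rewrite qQ ltxx.
congr (fine (P _)); apply/seteqP; split => w /=.
  by rewrite le_eqVlt => /predU1P[]; [right|left].
by case=> [/ltW//|->].
Qed.

Lemma reliability_limsup t : 0 <= t ->
  (limn_esup (fun n => `| reliability n t - P [set w | (t%:E < tau w)%E] |)
    <= P [set w | (L t w)%:E = level w])%E.
Proof.
move=> t0; apply: limn_esup_le_near => e e0; near=> n.
have n0 : (0 < n)%N by near: n; exists 1%N.
have mrel : measurable [set w | (t%:E < Tsys n w)%E].
  by apply: measurable_system_gt => //; exact: Phi_mixed.
have [_ -> PE] := prob_level t t0.
have /andP[H1 H2] := tau_sandwich t t0.
have H3 : fine (P [set w | q t w < Q w]) - e <= fine (reliability n t).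
  by near: n; exact: reliability_ge_near.
have H4 : fine (reliability n t) <= fine (P [set w | q t w <= Q w]) + e.
  by near: n; exact: reliability_le_near.
rewrite -[reliability n t]fineK ?fin_num_measure//.
rewrite -[P [set w | (t%:E < tau w)%E]]fineK ?fin_num_measure//; last exact: m_tau.
rewrite -[P [set w | q t w = Q w]]fineK ?fin_num_measure//; last exact: m_eq.
rewrite -EFinB -EFinD abse_EFin lee_fin ler_norml; apply/andP; split; lra.
Unshelve. all: by end_near. Qed.

(** The variable without an assumed density is frozen; the equation [1 - exp (- L_t) = Q] then has
    at most one solution in the other, which has no atom. *)
Let no_tie t : 0 <= t -> has_density P (L t) \/ has_density P Q ->
  P [set w | q t w = Q w] = 0%E.
Proof.
move=> t0; pose C := [set z : R * R | 1 - expR (- z.1) = z.2].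
have mC : measurable C.
  have m : measurable_fun setT (fun z : R * R => 1 - expR (- z.1) == z.2).
    exact: measurable_fun_eqr.
  have := m measurableT [set true]; rewrite setTI => /(_ I).
  by congr (measurable _); apply/seteqP; split => z /= /eqP.
case=> dens.
- pose C' := [set z : R * R | C (z.2, z.1)].
  have mC' : measurable C'.
    have := measurable_fun_pair (@measurable_snd _ _ R R) (@measurable_fst _ _ R R).
    by move=> /(_ measurableT _ mC); rewrite setTI.
  have QL A B : measurable A -> measurable B ->
      (P (Q @^-1` A `&` L t @^-1` B) = P (Q @^-1` A) * P (L t @^-1` B))%E.
    by move=> mA mB; rewrite setIC muleC L_Q_indep.
  rewrite (_ : [set w | _] = [set w | C' (Q w, L t w)])//.
  rewrite (prob_indep_pair P Q (L t) C' mQ (mL _ t0) QL mC').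
  apply: integral0_eq => w _.
  (* With [Q] frozen the equation may have no solution; if it has one, injectivity of the
     exponential makes the event a single value of [L t]. *)
  have [[v0 v0C]|noC] := pselect (exists v, C' (Q w, L t v)).
    rewrite (_ : [set v | _] = [set v | L t v = L t v0]); first exact: density_atomless.
    apply/seteqP; split => v; last by rewrite /C'/C/= => ->.
    move: v0C; rewrite /C'/C/= => <- vC.
    by apply: oppr_inj; apply: expR_inj; lra.
  by rewrite (_ : [set v | _] = set0) ?measure0// -subset0 => v vC; apply: noC; exists v.
- rewrite (_ : [set w | _] = [set w | C (L t w, Q w)])//.
  rewrite (prob_indep_pair P (L t) Q C (mL _ t0) mQ (L_Q_indep _ t0) mC).
  apply: integral0_eq => w _.
  rewrite (_ : [set v | _] = [set v | Q v = q t w]); first exact: density_atomless.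
  by apply/seteqP; split => v.
Qed.

Lemma reliability_cvg t : 0 <= t -> has_density P (L t) \/ has_density P Q ->
  reliability n t @[n --> \oo] --> P [set w | (t%:E < tau w)%E] /\
  reliability n t @[n --> \oo] --> P [set w | ((L t w)%:E < level w)%E].
Proof.
move=> t0 dens; have tie := no_tie t t0 dens.
have [-> _ PE] := prob_level t t0.
have /andP[H1 H2] := tau_sandwich t t0.
have tauE : P [set w | (t%:E < tau w)%E] = P [set w | q t w < Q w].
  rewrite -[LHS]fineK ?fin_num_measure//; last exact: m_tau.
  rewrite -[RHS]fineK ?fin_num_measure//; last exact: m_lt.
  by congr (_%:E); rewrite PE tie/= in H2; lra.
rewrite tauE; suff : reliability n t @[n --> \oo] --> P [set w | q t w < Q w] by [].
rewrite -[X in _ --> X]fineK ?fin_num_measure//; last exact: m_lt.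
apply/fine_cvgP; split.
  near=> n; have n0 : (0 < n)%N by near: n; exists 1%N.
  rewrite fin_num_measure//.
  by apply: measurable_system_gt => //; exact: Phi_mixed.
apply/cvgrPdist_le => e e0; near=> n.
have H3 : fine (P [set w | q t w < Q w]) - e <= fine (reliability n t).
  by near: n; exact: reliability_ge_near.
have H4 : fine (reliability n t) <= fine (P [set w | q t w <= Q w]) + e.
  by near: n; exact: reliability_le_near.
rewrite PE tie/= in H4; rewrite ler_norml /=; apply/andP; split; lra.
Unshelve. all: by end_near. Qed.

Let Tsys_ge0 n w : (0 <= Tsys n w)%E.
Proof. by apply: le_ereal_inf_tmp => _ [s [s0 _] <-]; rewrite lee_fin. Qed.

Let tau_ge0 w : (0 <= tau w)%E.
Proof. by apply: le_ereal_inf_tmp => _ [s [s0 _] <-]; rewrite lee_fin ltW. Qed.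

Let prob_tau_lt0 (t : R) : t < 0 -> P [set w | (tau w <= t%:E)%E] = 0%E.
Proof.
move=> t0; rewrite (_ : [set w | _] = set0) ?measure0// -subset0 => w /=.
by apply/negP; rewrite -ltNge; apply: lt_le_trans (tau_ge0 w); rewrite lte_fin.
Qed.

Lemma Tsys_cvg_in_distribution :
  has_density P Q \/ (forall t : R, 0 < t -> has_density P (L t)) ->
  cvg_in_distribution PS Tsys P tau.
Proof.
move=> dens t cont.
have setE (d' : measure_display) (T' : measurableType d') (P' : probability T' R)
    (X : T' -> \bar R) : measurable [set w | (t%:E < X w)%E] ->
    P' [set w | (X w <= t%:E)%E] = (1 - P' [set w | (t%:E < X w)%E])%E.
  move=> mX; rewrite -probability_setC//; congr (P' _).
  by apply/seteqP; split => w /=; rewrite leNgt => /negP.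
have [t0|t0|t0] := ltgtP t 0.
- rewrite prob_tau_lt0//; under eq_fun => n.
    rewrite (_ : [set w | _] = set0); last first.
      rewrite -subset0 => w /=; apply/negP; rewrite -ltNge.
      by apply: lt_le_trans (Tsys_ge0 n w); rewrite lte_fin.
    rewrite measure0; over.
  exact: cvg_cst.
- have densL : has_density P (L t) \/ has_density P Q.
    by case: dens => [|/(_ t t0)]; [right|left].
  have [relc _] := reliability_cvg t (ltW t0) densL.
  rewrite setE; last by apply: m_tau; exact: ltW.
  apply: cvg_trans (_ : (1 - reliability n t)%E @[n --> \oo] --> _).
    apply: near_eq_cvg; near=> n; apply/esym/setE.
    have n0 : (0 < n)%N by near: n; exists 1%N.
    by apply: measurable_system_gt; [exact: Phi_mixed|exact: ltW].
  apply: cvgeB => //; exact: cvg_cst.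
(* No density is assumed for [L] at time 0. As [P (tau <= s)] vanishes for [s < 0], continuity at 0
   forces [P (tau <= 0) = 0], and [reliability0] gives the same value for the systems with
   [n > 0]. *)
- subst t; have -> : P [set w | (tau w <= 0%:E)%E] = 0%E.
    apply: (cvg_unique _ (cvg_at_left_filter cont)) => //.
    apply: cvg_near_cst; near=> s.
    by apply: prob_tau_lt0; near: s; exact: nbhs_left_lt.
  apply: cvg_near_cst; near=> n.
  have n0 : (0 < n)%N by near: n; exists 1%N.
  rewrite setE; last by apply: measurable_system_gt => //; exact: Phi_mixed.
  by rewrite -/(reliability n 0) reliability0// subee.
Unshelve. all: by end_near. Qed.

End limit_theorem.

Theorem theorem1 (R : realType)
  (* the subordinator L and the limit Q *)
  (d : measure_display) (W : measurableType d) (P : probability W R)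
  (L : R -> W -> R) (Q : {RV P >-> R})
  (* the n-th system: random structure function and failure times *)
  (dE : nat -> measure_display) (E : forall n : nat, measurableType (dE n))
  (PS : forall n : nat, probability (E n) R)
  (Phi : forall n : nat, E n -> coherent_system n)
  (T : forall n : nat, {RV (PS n) >-> n.-tuple (\bar R)})
  (* the variables Q_n *)
  (dQ : nat -> measure_display) (V : forall n : nat, measurableType (dQ n))
  (PQ : forall n : nat, probability (V n) R)
  (Qn : forall n : nat, {RV (PQ n) >-> R})
  (L_subordinator : levy_subordinator P L)
  (Phi_mixed : forall n : nat, (0 < n)%N -> mixed_coherent_system (Phi n))
  (T_LFMO : forall n : nat, (0 < n)%N ->
     LFMO_law P L (distribution (PS n) (T n)))
  (Phi_T_indep : forall n : nat, (0 < n)%N ->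
     indep_systems (PS n)
       (preimage_set_system setT (Phi n) setT)
       (preimage_set_system setT (T n) measurable))
  (Qn_signature : forall n k : nat, (0 < n)%N -> (1 <= k <= n)%N ->
     PQ n (Qn n @^-1` [set k%:R / n.+1%:R]) = (signature (PS n) (Phi n) k)%:E)
  (hA : cvg_in_distribution PQ (fun n w => (Qn n w)%:E)
          P (fun w => (Q w)%:E))
  (hB : (fun n : nat =>
           fine ('E_(PQ n)[fun w => (1 / Num.sqrt (Qn n w * (1 - Qn n w)))%R])%E
           : R^o)
        =o_\oo (fun n : nat => Num.sqrt (n%:R : R) : R^o))
  (Q_L_indep : indep_systems P
     (preimage_set_system setT Q measurable)
     (sigma_family [set t : R | 0 <= t] L)) :
  let Tsys (n : nat) (w : E n) : \bar R :=
    system_time (val (Phi n w)) (fun i => tnth (T n w) i) in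
  let level (w : W) : \bar R := (- lne (1 - Q w)%:E)%E in
  let tau (w : W) : \bar R := passage_time (L ^~ w) (level w) in
  let reliability (n : nat) (t : R) : \bar R :=
    PS n [set w | (t%:E < Tsys n w)%E] in
  [/\ forall t : R, 0 < t ->
        (limn_esup (fun n =>
           `| reliability n t - P [set w | (t%:E < tau w)%E] |)
         <= P [set w | (L t w)%:E = level w])%E,
      forall t : R, 0 < t -> has_density P (L t) \/ has_density P Q ->
        reliability n t @[n --> \oo] --> P [set w | (t%:E < tau w)%E] /\
        reliability n t @[n --> \oo] --> P [set w | ((L t w)%:E < level w)%E] &
      has_density P Q \/ (forall t : R, 0 < t -> has_density P (L t)) ->
        cvg_in_distribution PS Tsys P tau].
Proof.
move=> Tsys level tau reliability; split.
- move=> t /ltW t0.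
  exact: (reliability_limsup P L Q PS Phi T PQ Qn).
- move=> t /ltW t0; exact: (reliability_cvg P L Q PS Phi T PQ Qn).
- exact: (Tsys_cvg_in_distribution P L Q PS Phi T PQ Qn).
Qed.
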